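(* Let $(Y,X),(Y_1,X_1),(Y_2,X_2),\ldots$ be i.i.d. random vectors in $\mathbb{R}\times\mathbb{R}^d$ ($d\ge1$) whose common distribution has a Lebesgue density $(y,x)\mapsto p(y,x)$, and let $f(x)=\int_{-\infty}^\infty p(y,x)\,dy$, $x\in\mathbb{R}^d$, be the marginal density of $X$. Let $I$ be a compact subset of $\mathbb{R}^d$ and let the kernel $K$ satisfy conditions (K.i), (K.ii), (K.iii), (K.iv) listed in the context and have support contained in $[-1/2,1/2]^d$. Suppose further that there exists an $\varepsilon>0$ such that $f$ is continuous and strictly positive on $J:=I^\varepsilon$ and that for all $z\in J$, $$\lim_{z'\to z}p(y,z')=p(y,z)\quad\text{for almost every }y\in\mathbb{R}.$$ Then for all sequences $0<a_n<b_n<1$ satisfying $b_n\to0$ and $na_n/\log n\to\infty$, $$\lim_{n\to\infty}\ \sup_{a_n\le h\le b_n}\ \sup_{z\in I}\big\|\widehat F_{n,h}(\cdot|z)-F(\cdot|z)\big\|_\infty=0\qquad\text{almost surely.}$$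
   Context: $F(t|z)=\mathbb{P}(Y\le t\,|\,X=z)$ is the conditional distribution function, and for $0<h<1$ the conditional empirical distribution function is $$\widehat F_{n,h}(t|z)=\frac{\sum_{i=1}^n\mathbf{1}(Y_i\le t)K((z-X_i)/h^{1/d})}{\sum_{i=1}^nK((z-X_i)/h^{1/d})}.$$ Here $\|\cdot\|_\infty$ is the supremum over $t\in\mathbb{R}$. For $I\subset\mathbb{R}^d$, $I^\varepsilon$ is the closed $\varepsilon$-neighborhood of $I$ with respect to the maximum norm $|x|_+=\max_{1\le i\le d}|x_i|$. A kernel is a measurable function $K:\mathbb{R}^d\to\mathbb{R}$. Conditions on $K$: (K.i) $\int_{\mathbb{R}^d}K(s)\,ds=1$. (K.ii) $\|K\|_\infty=\sup_{x\in\mathbb{R}^d}|K(x)|=\kappa<\infty$. Let $\mathcal{K}=\{K((x-\cdot)/h^{1/d}): h>0,\ x\in\mathbb{R}^d\}$. For $\varepsilon>0$ let $N(\varepsilon,\mathcal{K})=\sup_Q N(\kappa\varepsilon,\mathcal{K},d_Q)$, the supremum being over all probability measures $Q$ on the Borel sets of $\mathbb{R}^d$, where $d_Q$ is the $L_2(Q)$-metric and $N(\delta,\mathcal{K},d_Q)$ is the minimal number of balls $\{g: d_Q(g,g')<\delta\}$ of $d_Q$-radius $\delta$ needed to cover $\mathcal{K}$. (K.iii) For some $C>0$ and $\nu>0$, $N(\varepsilon,\mathcal{K})\le C\varepsilon^{-\nu}$ for all $0<\varepsilon<1$. (K.iv) $\mathcal{K}$ is a pointwise measurable class: there is a countable subclass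 $\mathcal{K}_0\subset\mathcal{K}$ such that for every $g\in\mathcal{K}$ there is a sequence $\{g_m\}$ in $\mathcal{K}_0$ with $g_m(z)\to g(z)$ for all $z\in\mathbb{R}^d$. *)

(* Defs.v *)
From HB Require Import structures.
From mathcomp Require Import all_boot all_order all_algebra.
From mathcomp Require Import all_classical all_reals all_analysis measurable_realfun.

Set Implicit Arguments.
Unset Strict Implicit.
Unset Printing Implicit Defensive.

Import Order.TTheory GRing.Theory Num.Theory.
Import numFieldTopology.Exports numFieldNormedType.Exports.

Local Open Scope classical_set_scope.
Local Open Scope ring_scope.

Fact rV_borel_display : measure_display.
Proof. exact: default_measure_display. Qed.

Section rV_borel.
Context {R : realType} {n : nat}.

Let borel : set_system 'rV[R]_n := <<s @open 'rV[R]_n >>.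

Let borel0 : borel set0. Proof. exact: sigma_algebra0. Qed.

Let borelC A : borel A -> borel (~` A). Proof. exact: sigma_algebraC. Qed.

Let borel_bigcup (F : (set 'rV[R]_n)^nat) :
  (forall i, borel (F i)) -> borel (\bigcup_i F i).
Proof. exact: sigma_algebra_bigcup. Qed.

HB.instance Definition _ := @isMeasurable.Build rV_borel_display 'rV[R]_n
  borel borel0 borelC borel_bigcup.

End rV_borel.

Lemma measurable_coord {R : realType} n (i : 'I_n) :
  measurable_fun setT (fun v : 'rV[R]_n => v ord0 i).
Proof.
apply: (measurability _ (RGenOpens.measurableE R)).
move=> _ [_ [a [b ->]] <-].
rewrite setTI; apply: sub_sigma_algebra.
by apply: open_comp => // x _; exact: coord_continuous.
Qed.

Lemma measurable_fun_rVP {R : realType} {d} (T : measurableType d) n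
    (f : T -> 'rV[R]_n) :
  measurable_fun setT f <-> forall i, measurable_fun setT (fun x => f x ord0 i).
Proof.
split=> [mf i|mf].
  exact: (measurableT_comp (measurable_coord i) mf).
have mE : @measurable _ 'rV[R]_n = <<s @open 'rV[R]_n >> by [].
apply: (measurability _ mE) => _ [U oU <-]; rewrite setTI.
pose rball (c : 'rV[rat]_n * nat) : set 'rV[R]_n :=
  \bigcap_(i in [set: 'I_n]) [set v | `|v ord0 i - ratr (c.1 ord0 i)| < c.2.+1%:R^-1].
have -> : U = \bigcup_(c in [set c | rball c `<=` U]) rball c.
  apply/seteqP; split=> [x Ux|x [c /= cU]]; last exact: cU.
  have /nbhs_ballP[e /= e0 xeU] : nbhs x U by exact: open_nbhs_nbhs.
  have e20 : 0 < e / 2 by rewrite divr_gt0.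
  have [k ke] : exists k : nat, k.+1%:R^-1 < e / 2.
    have [N _ /(_ N)] := near_infty_natSinv_lt (PosNum e20).
    by move=> /(_ (leqnn N)) ?; exists N.
  have k0 : 0 < k.+1%:R^-1 :> R by rewrite invr_gt0.
  have q (i : 'I_n) : {q : rat | `|x ord0 i - ratr q| < k.+1%:R^-1}.
    apply: cid.
    have /rat_in_itvoo[q] : x ord0 i - k.+1%:R^-1 < x ord0 i + k.+1%:R^-1.
      by rewrite ltrD2l gtrN.
    rewrite in_itv/= => /andP[xq qx]; exists q.
    by rewrite ltr_distlC xq qx.
  exists (\row_i sval (q i), k) => /=.
    move=> y yq; apply: xeU; split=> // i j; rewrite !ord1 /ball/=.
    have := yq j I; rewrite /= mxE; have := svalP (q j).
    move: (sval _) => r xr yr.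
    rewrite -(subrK (ratr r) (x _ _)) -addrA (le_lt_trans (ler_normD _ _))//.
    by rewrite [e]splitr ltrD// (lt_trans _ ke)// distrC.
  by move=> i _ /=; rewrite mxE; exact: svalP (q i).
rewrite preimage_bigcup bigcup_mkcond.
apply: countable_bigcupT_measurable; first exact: countableP.
move=> c; case: ifPn => // _.
rewrite /rball preimage_bigcap.
apply: fin_bigcap_measurable => // i _.
rewrite -[X in measurable X]setTI.
apply: (@measurable_fun_ltr _ _ _ _ (fun x => `|f x ord0 i - ratr (c.1 ord0 i)|) (cst _)) => //.
apply: measurableT_comp => //.
by apply: measurable_funB.
Qed.

Section lebesgue_rV.
Context {R : realType}.

Definition cons_rV n (u : R * 'rV[R]_n) : 'rV[R]_n.+1 :=
  row_mx u.1%:M u.2 : 'rV_(1 + n).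

Definition uncons_rV n (v : 'rV[R]_n.+1) : R * 'rV[R]_n :=
  (v ord0 ord0, rsubmx (v : 'rV_(1 + n))).

Lemma cons_rVK n : cancel (@cons_rV n) (@uncons_rV n).
Proof.
move=> [x v]; rewrite /uncons_rV /cons_rV /= row_mxKr; congr pair.
rewrite (_ : ord0 = lshift n (ord0 : 'I_1)); last exact/val_inj.
by rewrite (@row_mxEl _ _ 1) mxE eqxx mulr1n.
Qed.

Lemma cons_rV0 n u : @cons_rV n u ord0 ord0 = u.1.
Proof. by have := congr1 fst (cons_rVK u). Qed.

Lemma cons_rV_lift n u i : @cons_rV n u ord0 (lift ord0 i) = u.2 ord0 i.
Proof.
rewrite (_ : lift ord0 i = rshift 1 i); last exact/val_inj.
by rewrite /cons_rV (@row_mxEr _ 1 1).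
Qed.

Lemma uncons_rVK n : cancel (@uncons_rV n) (@cons_rV n).
Proof.
move=> v; apply/rowP => i; case: (unliftP ord0 i) => [j|] ->.
  rewrite cons_rV_lift mxE; congr (v _ _); exact/val_inj.
by rewrite cons_rV0.
Qed.

Lemma measurable_cons_rV n : measurable_fun setT (@cons_rV n).
Proof.
apply/measurable_fun_rVP => i; case: (unliftP ord0 i) => [j|] ->.
  under eq_fun do rewrite cons_rV_lift.
  by apply: (measurableT_comp (measurable_coord j)); exact: measurable_snd.
under eq_fun do rewrite cons_rV0.
exact: measurable_fst.
Qed.

Lemma measurable_uncons_rV n : measurable_fun setT (@uncons_rV n).
Proof.
apply: measurable_fun_pair; first exact: measurable_coord.
apply/measurable_fun_rVP => i; under eq_fun do rewrite mxE.
exact: measurable_coord.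
Qed.

Section step.
Context {n : nat}.
Variable mu : {sigma_finite_measure set 'rV[R]_n -> \bar R}.

Definition lebesgue_rV_step : set 'rV[R]_n.+1 -> \bar R :=
  pushforward (@lebesgue_measure R \x mu)%E (@cons_rV n).

Let mcons := @measurable_cons_rV n.

Let step0 : lebesgue_rV_step set0 = 0%E. Proof. exact: measure0. Qed.

Let step_ge0 A : (0 <= lebesgue_rV_step A)%E. Proof. exact: measure_ge0. Qed.

Let step_sigma_additive : semi_sigma_additive lebesgue_rV_step.
Proof. exact: measure_semi_sigma_additive. Qed.

HB.instance Definition _ := isMeasure.Build _ _ _ lebesgue_rV_step
  step0 step_ge0 step_sigma_additive.

Let step_sigma_finite : sigma_finite setT lebesgue_rV_step.
Proof.
have /sigma_finiteP[F [FT ndF Foo]] := sigma_finiteT (@lebesgue_measure R).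
have /sigma_finiteP[G [GT ndG Goo]] := sigma_finiteT mu.
exists (fun k => @uncons_rV n @^-1` (F k `*` G k)).
  rewrite -preimage_bigcup -(preimage_setT (@uncons_rV n)); congr (_ @^-1` _).
  rewrite -setXTT FT GT; apply/seteqP; split=> [[x v]|[x v] [k _ []]]; last first.
    by move=> /= ? ?; split; exists k.
  move=> [/= [k _ Fkx] [l _ Glv]]; exists (maxn k l) => //; split => /=.
  - by move: x Fkx; exact/subsetPset/ndF/leq_maxl.
  - by move: v Glv; exact/subsetPset/ndG/leq_maxr.
move=> k; have [mFk Fkoo] := Foo k; have [mGk Gkoo] := Goo k; split.
  rewrite -[X in measurable X]setTI; apply: measurable_uncons_rV => //.
  exact: measurableX.
rewrite /lebesgue_rV_step /pushforward -comp_preimage.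
rewrite (_ : _ \o _ = id); last by apply/funext => x /=; rewrite cons_rVK.
by rewrite preimage_id product_measure1E// lte_mul_pinfty// ge0_fin_numE.
Qed.

HB.instance Definition _ := Measure_isSigmaFinite.Build _ _ _ lebesgue_rV_step
  step_sigma_finite.

End step.

(* n-fold product of the Lebesgue measure on R, see lebesgue_rV_box. *)
Fixpoint lebesgue_rV n : {sigma_finite_measure set 'rV[R]_n -> \bar R} :=
  match n with
  | 0 => [the sigma_finite_measure _ _ of \d_(0 : 'rV[R]_0)]
  | m.+1 => lebesgue_rV_step (lebesgue_rV m)
  end.

Lemma lebesgue_rV_box n (A : 'I_n -> set R) : (forall i, measurable (A i)) ->
  lebesgue_rV n [set v | forall i, A i (v ord0 i)] =
  (\prod_(i < n) @lebesgue_measure R (A i))%E.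
Proof.
elim: n => [|n IH] in A * => mA.
  by rewrite big_ord0 /= diracE mem_set// => -[].
rewrite big_ord_recl/= -IH// -product_measure1E//; last first.
  rewrite [X in measurable X](_ : _ = \bigcap_(i in [set: 'I_n])
      ((fun v : 'rV[R]_n => v ord0 i) @^-1` A (lift ord0 i))).
    apply: fin_bigcap_measurable => // i _; rewrite -[X in measurable X]setTI.
    exact: measurable_coord.
  by apply/seteqP; split=> v /= vA i; [move=> _; exact: vA|exact: vA i I].
  exact: mA.
transitivity ((@lebesgue_measure R \x lebesgue_rV n)%E
  (@cons_rV n @^-1` [set v | forall i, A i (v ord0 i)])); first by [].
congr (product_measure1 _ _ _); apply/seteqP; split.
  move=> [x v] /= xvA; split=> [|i]; first by have := xvA ord0; rewrite cons_rV0.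
  by have := xvA (lift ord0 i); rewrite cons_rV_lift.
move=> [x v] /= [xA vA] i; case: (unliftP ord0 i) => [j|] ->.
  by rewrite cons_rV_lift.
by rewrite cons_rV0.
Qed.

End lebesgue_rV.

Section iid.
Context {R : realType} {d d' : measure_display}
  {Omega : measurableType d} {T : measurableType d'}.

Definition mutually_independent (P : probability Omega R)
    (W : nat -> {RV P >-> T}) :=
  forall (J : seq nat) (A : nat -> set T), uniq J ->
    (forall i, measurable (A i)) ->
    P (\bigcap_(i in [set` J]) (W i @^-1` A i)) =
    (\prod_(i <- J) P (W i @^-1` A i))%E.

Arguments mutually_independent P W : clear implicits.

Definition iid (P : probability Omega R) (W : nat -> {RV P >-> T}) :=
  mutually_independent P W /\
  forall i j (A : set T), measurable A ->
    distribution P (W i) A = distribution P (W j) A.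

Definition has_density (Q mu : {measure set T -> \bar R}) (p : T -> R) :=
  [/\ measurable_fun setT p, forall x, 0 <= p x &
      forall A, measurable A -> Q A = (\int[mu]_(x in A) (p x)%:E)%E].

End iid.
Arguments iid {R d d' Omega T} P W.

Section covering.
Context {R : realType} {d : measure_display} {T : measurableType d}.

Definition L2_dist (Q : probability T R) (g g' : T -> R) : \bar R :=
  'N[Q]_2%:E[EFin \o (g \- g')%R]%E.

(* Centers range over L_2(Q) rather than over the covered class; the value is
   +oo when there is no finite cover. *)
Definition covering_number (Q : probability T R) (delta : R)
    (G : set (T -> R)) : \bar R :=
  ereal_inf [set m%:R%:E | m in [set m : nat |
    exists c : 'I_m -> T -> R, (forall j, c j \in Lfun Q 2%:E) /\
      forall g, G g ->
        exists j, (L2_dist Q g (c j) < delta%:E)%E]].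

Definition pointwise_measurable (G : set (T -> R)) :=
  exists G0 : set (T -> R), [/\ countable G0, G0 `<=` G &
    forall g, G g -> exists u : nat -> T -> R,
      (forall m, G0 (u m)) /\ forall z, u m z @[m --> \oo] --> g z].

End covering.

Section kernel.
Context {R : realType} {d : nat}.
Implicit Types (K : 'rV[R]_d -> R) (x z : 'rV[R]_d) (h : R).

Definition rescale K h x z : R := K ((h `^ d%:R^-1)^-1 *: (x - z)).

Definition kernel_class K : set ('rV[R]_d -> R) :=
  [set g | exists h x, 0 < h /\ g = rescale K h x].

Definition sup_abs K : \bar R := ereal_sup (range (fun x => `|K x|%:E)).

Definition uniform_covering_number K (eps : R) : \bar R :=
  ereal_sup (range (fun Q : probability 'rV[R]_d R =>
    covering_number Q (fine (sup_abs K) * eps) (kernel_class K))).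

Record regular_kernel K : Prop := {
  kernel_measurable : measurable_fun setT K ;
  kernel_integral : (\int[lebesgue_rV d]_s (K s)%:E = 1)%E ;
  kernel_bounded : (sup_abs K < +oo)%E ;
  kernel_covering : exists C nu : R, [/\ 0 < C, 0 < nu &
    forall eps, 0 < eps < 1 ->
      (uniform_covering_number K eps <= (C * eps `^ (- nu))%:E)%E] ;
  kernel_class_measurable : pointwise_measurable (kernel_class K) }.

End kernel.

Section conditional_cdf.
Context {R : realType} {d : nat}.
Implicit Types (p : R * 'rV[R]_d -> R) (t : R) (z : 'rV[R]_d).

(* Equal to 0 where the integral diverges, hence 0 < marginal p z implies that
   p (_, z) is integrable. *)
Definition marginal p z : R := \int[lebesgue_measure]_y p (y, z).

Definition cond_cdf p t z : R :=
  (\int[lebesgue_measure]_(y in `]-oo, t]) p (y, z)) / marginal p z.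

(* The sample is (yx 1, ..., yx n); yx 0 is not part of it. A vanishing
   denominator gives the value 0. *)
Definition emp_cond_cdf K (yx : nat -> R * 'rV[R]_d) (n : nat) (h t : R) z : R :=
  (\sum_(1 <= i < n.+1) \1_`]-oo, t] (yx i).1 * rescale K h z (yx i).2) /
  (\sum_(1 <= i < n.+1) rescale K h z (yx i).2).

(* `|_| is the maximum norm on 'rV[R]_d; the infimum defining the distance to I
   is attained as I is compact. *)
Definition closed_nbhd (I : set 'rV[R]_d) (e : R) : set 'rV[R]_d :=
  [set x | exists2 y, I y & `|x - y| <= e].

End conditional_cdf.

(* cond_cdf p is a version of P(Y <= t | X = z) when (Y, X) has density p. *)
Section cond_cdf_spec.
Local Open Scope ereal_scope.
Context {R : realType} {d : nat}.
Variables (Q : probability (measurableTypeR R * 'rV[R]_d)%type R)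
  (p : R * 'rV[R]_d -> R).
Hypothesis Qp : has_density Q (@lebesgue_measure R \x lebesgue_rV d) p.

Let section (A : set R) z := \int[@lebesgue_measure R]_(y in A) (p (y, z))%:E.

Let p_ge0 u : (0 <= p u)%R. Proof. by have [] := Qp. Qed.

Let section_ge0 A z : 0 <= section A z.
Proof. by apply: integral_ge0 => y _; rewrite lee_fin. Qed.

Let measurable_patch (C : set (measurableTypeR R * 'rV[R]_d)%type) :
  measurable C -> measurable_fun setT ((EFin \o p) \_ C).
Proof.
move=> mC; apply/(measurable_restrictT _ mC); apply: measurable_funTS.
by have [mp _ _] := Qp; exact: measurableT_comp.
Qed.

Let patch_ge0 (C : set (measurableTypeR R * 'rV[R]_d)%type) u :
  0 <= ((EFin \o p) \_ C) u.
Proof. by apply: erestrict_ge0 => v; rewrite lee_fin. Qed.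

Let sectionE (A : set (measurableTypeR R)) (B : set 'rV[R]_d) z :
  fubini_G (@lebesgue_measure R) ((EFin \o p) \_ (A `*` B)) z =
  (section A \_ B) z.
Proof.
rewrite /fubini_G patchE; case: ifPn => zB.
  rewrite /section [RHS]integral_mkcond; apply: eq_integral => y _.
  by rewrite !patchE in_setX zB andbT.
by rewrite integral0_eq// => y _; rewrite patchE in_setX (negbTE zB) andbF.
Qed.

Let measurable_section (A : set (measurableTypeR R)) : measurable A ->
  measurable_fun setT (section A).
Proof.
move=> mA; rewrite (_ : section A = fubini_G (@lebesgue_measure R)
  ((EFin \o p) \_ (A `*` [set: 'rV[R]_d]))); last first.
  by apply/funext => z; rewrite sectionE patch_setT.
apply: measurable_fun_fubini_tonelli_G => //.
by apply: measurable_patch; exact: measurableX.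
Qed.

Let density_rect (A : set (measurableTypeR R)) (B : set 'rV[R]_d) :
  measurable A -> measurable B ->
  Q (A `*` B) = \int[lebesgue_rV d]_(z in B) section A z.
Proof.
move=> mA mB; have [_ _ ->] := Qp; last exact: measurableX.
rewrite integral_mkcond fubini_tonelli2//=; last first.
  by apply: measurable_patch; exact: measurableX.
by rewrite [RHS]integral_mkcond; apply: eq_integral => z _; rewrite -sectionE.
Qed.

Lemma cond_cdfP t (B : set 'rV[R]_d) : measurable B ->
  Q (`]-oo, t] `*` B) =
  \int[lebesgue_rV d]_(z in B) (cond_cdf p t z * marginal p z)%:E.
Proof.
move=> mB; rewrite density_rect//.
have fin : {ae lebesgue_rV d, forall z, setT z -> section setT z \is a fin_num}.
  apply: integrable_ae => //; apply/integrableP; split.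
    exact: measurable_section.
  under eq_integral do rewrite gee0_abs//.
  by rewrite -density_rect// setXTT probability_setT ltry.
have mrat : measurable_fun setT (fun z => (cond_cdf p t z * marginal p z)%:E).
  have mfs A : measurable A -> measurable_fun setT (fine \o section A).
    move=> mA; apply: measurableT_comp (measurable_section mA).
    exact: fine_measurable.
  pose N := [set z | fine (section setT z) != 0%R].
  have mN : measurable N.
    rewrite (_ : N = setT `&` (fine \o section setT) @^-1` ~` [set 0%R]).
      by apply: mfs => //; exact: measurableC.
    by rewrite setTI; apply/seteqP; split=> z /= /eqP.
  apply/measurable_EFinP.
  rewrite (_ : (fun _ => _) = (fine \o section `]-oo, t]) \_ N).
    by apply/(measurable_restrictT _ mN); apply: measurable_funTS; exact: mfs.
  apply/funext => z; rewrite patchE; case: ifPn => [/set_mem zN|].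
    by rewrite /cond_cdf divfK.
  rewrite notin_setE /N/= => /negP; rewrite negbK => /eqP zN.
  by rewrite [marginal _ _]zN mulr0.
have section_le z : section `]-oo, t] z <= section setT z.
  apply: ge0_subset_integral => //.
  - have [mp _ _] := Qp; apply: measurableT_comp => //.
    exact: (measurableT_comp mp (pair2_measurable z)).
  - by move=> y _; rewrite lee_fin.
apply: ge0_ae_eq_integral => //.
- by apply: measurable_funTS; exact: measurable_section.
- by apply: measurable_funTS.
- move=> z _; rewrite lee_fin mulr_ge0// ?divr_ge0//;
    by apply: fine_ge0; exact: section_ge0.
apply: filterS fin => z /(_ I) finz _; rewrite /cond_cdf /marginal /Rintegral.
rewrite -/(section _ _) -/(section _ _).
have fint : section `]-oo, t] z \is a fin_num.
  by rewrite ge0_fin_numE// (le_lt_trans (section_le z))// -ge0_fin_numE.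
have [s0|s0] := eqVneq (fine (section setT z)) 0%R.
  rewrite s0 mulr0; apply/eqP; rewrite eq_le section_ge0 andbT.
  by rewrite (le_trans (section_le z))// -(fineK finz) s0.
by rewrite divfK// fineK.
Qed.

End cond_cdf_spec.

(* Supremum in [0, +oo], so that the supremum over the empty set is 0. *)
Definition nnsup {R : realType} {T : Type} (A : set T) (f : T -> \bar R) :
    \bar R :=
  ereal_sup (0%E |` (f @` A)).

(* Main.v *)
From HB Require Import structures.
Require Import Defs.
From mathcomp Require Import all_boot all_order all_algebra.
From mathcomp Require Import all_classical all_reals all_analysis.
From mathcomp Require Import measurable_realfun ring lra zify.

Set Implicit Arguments.
Unset Strict Implicit.
Unset Printing Implicit Defensive.

Import Order.TTheory GRing.Theory Num.Theory.
Import numFieldTopology.Exports numFieldNormedType.Exports.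

Local Open Scope classical_set_scope.
Local Open Scope ring_scope.

(** Numerator and denominator of the estimator are sums over the sample of
    functions 1(y <= t) g(x) and g(x), where g(x) = K((z - x) / s) and
    s ^ d = h. The theorem follows once, uniformly in t, in z in I and in
    a_n <= h <= b_n, these sums are within o(n h) of their means, the mean of
    the first is F(t|z) times the mean of the second up to o(n h), and the mean
    of the second is at least a constant times n h.

    Means. The function g lives on the cube of volume h centered at z, which
    shrinks to z. Near each point of I the densities p(., x) converge pointwise
    almost everywhere while their masses f(x) converge, so by Scheffe's lemma
    x |-> p(., x) is continuous into L1 there; compactness makes this uniform on
    I (section_below_uniform). By Fubini a mean is the integral over the cube of
    g(x) times a section of p that is almost constant in x (smoothing_bias,
    kernel_mean, kernel_mean_cond_cdf).

    Fluctuations. Since only o(n h) is wanted and n a_n >> log n, no chaining is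
    needed: a cover at one scale, of cardinality polynomial in n, together with
    a bound exp(- c n a_n) for each of its elements, gives summable
    probabilities. The heart is relative_deviation_probability: for a countable
    class of functions f with |f| <= 1 and such covers, off an event whose
    probability is at most four times the size of the cover times such a bound,
      |sum f(X_i) - n E f| <= e (n E f^2 + sum f(X_i)^2 + n a)
    for all f at once. Its proof compares the sample with an independent copy of
    it, then exchanges the two members of each pair at random: given the pairs,
    only finitely many functions matter, up to a small error, and each one is a
    Rademacher sum. The cover may then depend on the observed points, which is
    what the covering numbers, uniform over all probability measures, control.

    The normalization by second moments instead of h serves two purposes. It
    makes the Rademacher bound independent of the variances, which need not be
    known in advance. And it survives bounded pointwise limits: the countable
    subclass given by pointwise measurability may approximate the kernel
    function of one bandwidth by those of very different bandwidths, so that an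
    inequality normalized by h would not pass from the countable subclass to the
    whole class, whereas this one does (halfline_kernel_deviation). In the end
    E f^2 is O(h), and the inequality for f^2 in place of f shows that
    sum f(X_i)^2 is O(n h) (sum_deviation). *)

(** * The law of an i.i.d. sequence *)

Definition cylinders d (T : measurableType d) : set (set (nat -> T)) :=
  [set E | exists n (A : nat -> set T), (forall i, measurable (A i)) /\
    E = [set x | forall i, (i < n)%N -> A i (x i)]].

(** Infinite sequences with the sigma-algebra of the coordinates. Events of this
    space turn statements about the joint law of an i.i.d. sequence into
    statements about a single measure. *)
Definition seq_space d (T : measurableType d) :=
  g_sigma_algebraType (@cylinders d T).

HB.instance Definition _ d (T : measurableType d) :=
  Measurable.on (@seq_space d T).

Section seq_space_theory.
Context d (T : measurableType d).

Lemma cylindersI : setI_closed (@cylinders d T).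
Proof.
move=> _ _ [n [A [mA ->]]] [m [B [mB ->]]].
exists (maxn n m); exists (fun i => (if (i < n)%N then A i else setT) `&`
  (if (i < m)%N then B i else setT)); split.
  by move=> i; apply: measurableI; case: ifP.
apply/seteqP; split=> [x /= [Ax Bx] i _|x /= ABx].
  by split; case: ifP => // ?; [exact: Ax|exact: Bx].
by split=> i ilt; have := ABx i; rewrite leq_max ilt ?orbT => /(_ isT) [].
Qed.

Lemma cylindersT : @cylinders d T setT.
Proof.
exists 0, (fun=> setT); split=> //.
by apply/seteqP; split.
Qed.

Lemma measurable_coordinate i :
  measurable_fun setT (fun x : seq_space T => x i).
Proof.
move=> _ A mA; rewrite setTI; apply: sub_sigma_algebra.
exists i.+1, (fun j => if j == i then A else setT); split.
  by move=> j; case: ifP.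
apply/seteqP; split=> [x /= Ax j _|x /= /(_ i)].
  by case: eqP => // ->.
by rewrite ltnSn eqxx; exact.
Qed.

Lemma measurable_fun_seq d' (S : measurableType d') (f : S -> seq_space T) :
  (forall i, measurable_fun setT (fun w => f w i)) -> measurable_fun setT f.
Proof.
have mE : @measurable _ (seq_space T) = <<s @cylinders d T >> by [].
move=> mf; apply: (measurability _ mE) => _ [_ [n [A [mA ->]]] <-]; rewrite setTI.
rewrite [X in measurable X](_ : _ =
  \bigcap_(i in [set i | (i < n)%N]) (setT `&` (fun w => f w i) @^-1` A i)).
  by apply: bigcap_measurableType => i _; exact: mf.
by apply/seteqP; split=> w /= fA i /= ilt; [split=> //; exact: fA|have [] := fA i ilt].
Qed.

(** Cylinders form a pi-system, so they determine finite measures. *)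
Lemma seq_measure_unique (R : realType)
    (m1 m2 : {measure set (seq_space T) -> \bar R}) :
  (m1 setT < +oo)%E -> (forall A, cylinders A -> m1 A = m2 A) ->
  forall A, measurable A -> m1 A = m2 A.
Proof.
move=> m1oo m12 A mA.
have mE : @measurable _ (seq_space T) = <<s @cylinders d T >> by [].
apply: (@measure_unique _ R (seq_space T) (@cylinders d T) (fun=> setT) mE
  cylindersI (fun=> cylindersT) _ m1 m2 m12 (fun=> m1oo) A mA).
by rewrite bigcup_const//; exists 0%N.
Qed.

End seq_space_theory.

Section seq_law.
Context {R : realType} d (Omega : measurableType d) d' (T : measurableType d').
Variables (P : probability Omega R) (W : nat -> {RV P >-> T}).
Hypothesis W_iid : iid P W.
Implicit Types (s : nat -> nat).

Definition subsample s (w : Omega) : seq_space T := fun i => W (s i) w.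

Lemma measurable_subsample s : measurable_fun setT (subsample s).
Proof. by apply: measurable_fun_seq => i; exact: measurable_funPT. Qed.

Lemma subsample_preimage_measurable s (E : set (seq_space T)) :
  measurable E -> measurable (subsample s @^-1` E).
Proof.
by move=> mE; rewrite -[X in measurable X]setTI; exact: measurable_subsample.
Qed.

Lemma marginal_law i (A : set T) : measurable A ->
  P (W i @^-1` A) = distribution P (W 0%N) A.
Proof. by move=> mA; rewrite -(W_iid.2 i 0%N). Qed.

(** The right-hand side does not involve [s]: this is where independence and
    equality of the laws enter, and everything about joint laws follows. *)
Lemma cylinder_law s n (A : nat -> set T) : injective s ->
  (forall i, measurable (A i)) ->
  P [set w | forall i, (i < n)%N -> A i (W (s i) w)] =
  (\prod_(i < n) distribution P (W 0%N) (A i))%E.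
Proof.
move=> injs mA; pose J := map s (iota 0 n).
have uJ : uniq J by rewrite map_inj_uniq// iota_uniq.
have := W_iid.1 J (fun j => A (index j J)) uJ (fun=> mA _).
rewrite [X in P X = _](_ : _ = [set w | forall i, (i < n)%N -> A i (W (s i) w)]).
  move=> ->; rewrite big_map.
  rewrite -[in LHS](subn0 n) -/(index_iota 0 n) big_mkord.
  apply: eq_bigr => i _; rewrite marginal_law// index_map//.
  by rewrite -[X in index X _](nth_iota 0 0 (ltn_ord i)) index_uniq ?size_iota ?iota_uniq.
have idx i : (i < n)%N -> index (s i) J = i.
  move=> ilt; rewrite index_map//.
  by rewrite -[X in index X _](nth_iota 0 0 ilt) index_uniq ?size_iota ?iota_uniq.
apply/seteqP; split=> [w /= wA i ilt|w /= wA _ /mapP[i + ->]].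
  have := wA (s i); rewrite /= idx//; apply.
  by apply/mapP; exists i; rewrite // mem_iota.
by rewrite mem_iota/= add0n => ilt; rewrite idx//; exact: wA.
Qed.

(** Exchangeability: relabelling an i.i.d. sequence injectively preserves its
    law, by uniqueness from the cylinders. *)
Lemma subsample_law s (E : set (seq_space T)) : injective s -> measurable E ->
  P (subsample s @^-1` E) = P (subsample id @^-1` E).
Proof.
move=> injs mE.
pose ms := isMeasurableFun.Build _ _ _ _ _ (measurable_subsample s).
pose Xs : {mfun Omega >-> seq_space T} := HB.pack (subsample s) ms.
pose mi := isMeasurableFun.Build _ _ _ _ _ (measurable_subsample id).
pose Xi : {mfun Omega >-> seq_space T} := HB.pack (subsample id) mi.
apply: (seq_measure_unique (m1 := distribution P Xs)
  (m2 := distribution P Xi)) => //.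
  by rewrite (le_lt_trans (probability_le1 _ _))// ?ltry.
move=> _ [n [A [mA ->]]]; rewrite /distribution /pushforward/=.
rewrite [LHS](cylinder_law _ injs)//.
by rewrite [RHS](cylinder_law _ (@inj_id nat)).
Qed.

(** Interleaving [s] and [s'] into one injection [t] turns the intersection of
    the two cylinders into a single cylinder. *)
Lemma cylinders_indep s s' n n' (A A' : nat -> set T) :
  injective s -> injective s' -> (forall i j, s i != s' j) ->
  (forall i, measurable (A i)) -> (forall i, measurable (A' i)) ->
  P ([set w | forall i, (i < n)%N -> A i (W (s i) w)] `&`
     [set w | forall i, (i < n')%N -> A' i (W (s' i) w)]) =
  (P [set w | forall i, (i < n)%N -> A i (W (s i) w)] *
   P [set w | forall i, (i < n')%N -> A' i (W (s' i) w)])%E.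
Proof.
move=> injs injs' dis mA mA'.
rewrite (cylinder_law _ injs)// (cylinder_law _ injs')//.
pose t k := if odd k then s' k./2 else s k./2.
have injt : injective t.
  move=> k l; rewrite /t; case: ifPn => ok; case: ifPn => ol.
  - by move=> /injs' kl; rewrite -(odd_double_half k) -(odd_double_half l) kl ok ol.
  - by move=> /esym/eqP; rewrite (negbTE (dis _ _)).
  - by move=> /eqP; rewrite (negbTE (dis _ _)).
  - move=> /injs kl; rewrite -(odd_double_half k) -(odd_double_half l) kl.
    by rewrite (negbTE ok) (negbTE ol).
pose B k := if odd k then (if (k./2 < n')%N then A' k./2 else setT) else
  (if (k./2 < n)%N then A k./2 else setT).
have mB k : measurable (B k) by rewrite /B; repeat case: ifP => //.
have := cylinder_law (maxn n n').*2 injt mB.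
rewrite [X in P X = _](_ : _ =
    ([set w | forall i, (i < n)%N -> A i (W (s i) w)] `&`
     [set w | forall i, (i < n')%N -> A' i (W (s' i) w)])).
  move=> ->.
  have prodE (F : nat -> \bar R) m : (\prod_(k < m.*2) F k =
      (\prod_(i < m) F i.*2) * (\prod_(i < m) F i.*2.+1))%E.
    elim: m => [|m IH]; first by rewrite !big_ord0 mule1.
    by rewrite doubleS !big_ord_recr/= IH -muleA muleACA.
  rewrite (prodE (fun k => distribution P (W 0%N) (B k))).
  have widen (C : nat -> set T) m M : (m <= M)%N ->
     (\prod_(i < M) distribution P (W 0%N) (if (i < m)%N then C i else setT) =
      \prod_(i < m) distribution P (W 0%N) (C i))%E.
    move=> mM; rewrite (big_ord_widen M (fun i => distribution P (W 0%N) (C i)))//.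
    rewrite [RHS]big_mkcond/=; apply: eq_bigr => i _.
    by case: ifP => // _; rewrite probability_setT.
  congr (_ * _)%E.
    rewrite -(widen A n (maxn n n')) ?leq_maxl//; apply: eq_bigr => i _.
    by rewrite /B odd_double doubleK.
  rewrite -(widen A' n' (maxn n n')) ?leq_maxr//; apply: eq_bigr => i _.
  by rewrite /B /= odd_double/= uphalf_double.
apply/seteqP; split=> [w /= wB|w /= [wA wA'] k klt].
  split=> i ilt.
    have := wB i.*2; rewrite /B /t odd_double doubleK ilt; apply.
    by rewrite ltn_double leq_max ilt.
  have := wB i.*2.+1; rewrite /B /t /= odd_double/= uphalf_double ilt; apply.
  by rewrite ltn_Sdouble leq_max ilt orbT.
rewrite /B /t; case: ifP => ok; case: ifP => // kn; [exact: wA'|exact: wA].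
Qed.

(** Uniqueness of measures is used twice: first the left event becomes arbitrary
    while the right one stays a cylinder, then the right one. *)
Lemma subsamples_indep s s' (E E' : set (seq_space T)) :
  injective s -> injective s' -> (forall i j, s i != s' j) ->
  measurable E -> measurable E' ->
  P (subsample s @^-1` E `&` subsample s' @^-1` E') =
  (P (subsample s @^-1` E) * P (subsample s' @^-1` E'))%E.
Proof.
move=> injs injs' dis mE mE'.
pose mk t : {mfun Omega >-> seq_space T} := HB.pack (subsample t)
  (isMeasurableFun.Build _ _ _ _ _ (measurable_subsample t)).
have extend (B : set Omega) t : measurable B ->
    (forall C, cylinders C -> P (subsample t @^-1` C `&` B) =
      (P (subsample t @^-1` C) * P B)%E) ->
    forall C : set (seq_space T), measurable C ->
      P (subsample t @^-1` C `&` B) = (P (subsample t @^-1` C) * P B)%E.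
  move=> mB H C mC.
  have PB0 : 0 <= fine (P B) by exact: fine_ge0.
  pose m1 := pushforward (mrestr P mB) (mk t).
  pose m2 := mscale (NngNum PB0) (distribution P (mk t)).
  have m12 : m1 C = m2 C.
    apply: (@seq_measure_unique _ T R m1 m2) => //.
      rewrite (le_lt_trans (probability_le1 _ _))// ?ltry//.
      by apply: measurableI => //; exact: subsample_preimage_measurable.
    move=> A cA; transitivity ((fine (P B))%:E * P (subsample t @^-1` A))%E => //.
    by rewrite fineK ?fin_num_measure// muleC -H//.
  transitivity (m1 C) => //; rewrite m12.
  transitivity ((fine (P B))%:E * P (subsample t @^-1` C))%E => //.
  by rewrite fineK ?fin_num_measure// muleC.
apply: (extend) => // [|C [n [A [mA ->]]]].
  exact: subsample_preimage_measurable.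
rewrite setIC muleC; apply: (extend) => // [|C' [n' [A' [mA' ->]]]].
  apply: (@subsample_preimage_measurable s).
  by apply: sub_sigma_algebra; exists n, A.
rewrite setIC muleC; exact: cylinders_indep.
Qed.

End seq_law.

(** * Moments of sums *)

Lemma bounded_integrable {R : realType} d (T : measurableType d)
    (mu : {finite_measure set T -> \bar R}) (f : T -> R) (c : R) :
  measurable_fun setT f -> (forall x, `|f x| <= c) ->
  mu.-integrable setT (EFin \o f).
Proof.
move=> mf fc; apply: measurable_bounded_integrable => //.
  by rewrite ltey_eq fin_num_measure.
exists c; split; first exact: num_real.
by move=> M cM x _; exact: le_trans (fc x) (ltW cM).
Qed.

Lemma bounded_Lfun {R : realType} d (T : measurableType d)
    (P : probability T R) (f : T -> R) (c : R) :
  measurable_fun setT f -> (forall x, `|f x| <= c) -> f \in Lfun P 2%:E.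
Proof.
move=> mf fc; rewrite inE; apply/andP; split; rewrite inE//=.
rewrite /finite_norm unlock /Lnorm poweR_lty//.
have mf2 : measurable_fun setT (fun x => `|f x| `^ 2).
  apply: (@measurableT_comp _ _ _ _ _ _ (@powR R ^~ 2)) => //.
  exact: measurableT_comp.
have : P.-integrable setT (EFin \o (fun x => `|f x| `^ 2)).
  apply: (@bounded_integrable _ _ _ P _ (c `^ 2)) => // x.
  rewrite ger0_norm ?powR_ge0//.
  apply: ge0_ler_powR; rewrite ?nnegrE//.
  exact: le_trans (normr_ge0 _) (fc x).
move=> /integrableP[_]; apply: le_lt_trans.
rewrite le_eqVlt; apply/orP; left; apply/eqP; apply: eq_integral => x _ /=.
by rewrite (ger0_norm (powR_ge0 _ _)).
Qed.

Section moments.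
Context {R : realType} d (Omega : measurableType d) d' (T : measurableType d').
Variables (P : probability Omega R) (W : nat -> {RV P >-> T}).
Hypothesis W_iid : iid P W.
Let Q := distribution P (W 0%N).

Variables (f : T -> R) (mf : measurable_fun setT f) (f1 : forall x, `|f x| <= 1).

Let fW i : Omega -> R := f \o W i.

Let mfW i : measurable_fun setT (fW i).
Proof. by apply: measurableT_comp. Qed.

Let fW2 i : fW i \in Lfun P 2%:E.
Proof. by apply: (@bounded_Lfun _ _ _ P _ 1) => // w; exact: f1. Qed.

Let fW1 i : fW i \in Lfun P 1.
Proof. by apply: Lfun_subset12 (fW2 i); exact: fin_num_measure. Qed.

Lemma expectation_iid (g : T -> R) i : measurable_fun setT g ->
  (forall x, `|g x| <= 1) -> ('E_P[g \o W i])%E = (\int[Q]_x g x)%:E.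
Proof.
move=> mg g1; rewrite unlock fineK; last first.
  by apply: integrable_fin_num => //; exact: (bounded_integrable _ mg g1).
rewrite -(@integral_distribution _ _ _ _ _ P (W i) (EFin \o g))//; last 2 first.
- exact/measurable_EFinP.
- have mgW : measurable_fun setT (g \o W i) by exact: measurableT_comp.
  by apply: (@bounded_integrable _ _ _ P _ 1 mgW) => w; exact: g1.
by apply: eq_measure_integral => A mA _; exact: W_iid.2.
Qed.

(** Independence of two terms says that their joint law is a product measure;
    the expectation factors by Fubini. *)
Lemma expectation_prod_iid i j : i != j ->
  ('E_P[fW i * fW j])%E = ((\int[Q]_x f x) * (\int[Q]_x f x))%:E.
Proof.
move=> ij.
have mpair : measurable_fun setT (fun w => (W i w, W j w)).
  by apply: measurable_fun_pair.
pose WW : {mfun Omega >-> (T * T)%type} := HB.pack (fun w => (W i w, W j w))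
  (isMeasurableFun.Build _ _ _ _ _ mpair).
pose ff (z : T * T) : R := f z.1 * f z.2.
have mff : measurable_fun setT ff.
  by apply: measurable_funM; apply: measurableT_comp.
have ff1 z : `|ff z| <= 1 by rewrite normrM mulr_ile1.
have -> : ('E_P[fW i * fW j])%E = (\int[distribution P WW]_z (ff z)%:E)%E.
  rewrite unlock [RHS]integral_distribution//; first exact/measurable_EFinP.
  have mffW : measurable_fun setT (ff \o WW) by exact: measurableT_comp.
  by apply: (@bounded_integrable _ _ _ P _ 1 mffW) => w; exact: ff1.
have QQ (X : set (T * T)) : measurable X ->
    (Q \x Q)%E X = distribution P WW X.
  apply: product_measure_unique => A B mA mB.
  have := W_iid.1 [:: i; j] (fun k => if k == i then A else B).
  rewrite /= inE ij => /(_ isT) /(_ _)/[!big_cons]/[!big_nil].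
  rewrite eqxx eq_sym (negbTE ij) mule1 => H.
  transitivity (P (W i @^-1` A) * P (W j @^-1` B))%E; last first.
    by congr (_ * _)%E; rewrite (marginal_law W_iid).
  rewrite -H; last by move=> k; case: ifP.
  rewrite /distribution /pushforward; congr (P _); apply/seteqP; split.
    move=> w /= [Aw Bw] k /=; rewrite !inE => /orP[/eqP ->|/eqP ->].
      by rewrite eqxx.
    by rewrite eq_sym (negbTE ij).
  move=> w /= ABw; split.
    by have := ABw i; rewrite /= eqxx !inE eqxx => /(_ isT).
  by have := ABw j; rewrite /= eq_sym (negbTE ij) !inE eqxx orbT => /(_ isT).
transitivity (\int[Q \x Q]_z (ff z)%:E)%E.
  by apply: eq_measure_integral => A mA _; exact/esym/QQ.
have int : (Q \x Q)%E.-integrable setT (EFin \o ff).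
  apply/integrableP; split; first exact/measurable_EFinP.
  rewrite (eq_measure_integral (distribution P WW)); last by move=> A mA _; exact: QQ.
  by have /integrableP[] := bounded_integrable (distribution P WW) mff ff1.
rewrite -integral12_prod_meas1//.
have intf : Q.-integrable setT (EFin \o f) by exact: (bounded_integrable _ mf f1).
have Ef : (\int[Q]_y (f y)%:E)%E = (\int[Q]_y f y)%:E.
  by rewrite fineK// integrable_fin_num.
transitivity (\int[Q]_x ((f x)%:E * (\int[Q]_y f y)%:E))%E.
  apply: eq_integral => x _; rewrite /fubini_F.
  under eq_integral => y _ do rewrite /= /ff EFinM.
  by rewrite /= (@integralZl _ _ _ _ _ _ (EFin \o f))// Ef.
by rewrite integralZr// Ef.
Qed.

Let S (s : nat -> nat) n : Omega -> R := fun w => \sum_(i < n) f (W (s i) w).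

Let SS s n : S s n.+1 = S s n \+ fW (s n).
Proof. by apply/funext => w; rewrite /S big_ord_recr. Qed.

Let S0 s : S s 0 = cst 0.
Proof. by apply/funext => w; rewrite /S big_ord0. Qed.

Let S2 s n : S s n \in Lfun P 2%:E.
Proof.
elim: n => [|n IH].
  by rewrite S0 Lfun_cst.
by rewrite SS; apply: rpredD => //; rewrite lee1n.
Qed.

Let expectation_sum_iid s n :
  ('E_P[S s n])%E = (n%:R * \int[Q]_x f x)%:E.
Proof.
elim: n => [|n IH]; first by rewrite mul0r S0 expectation_cst.
rewrite SS expectationD ?fW1//; last first.
  by apply: Lfun_subset12 (S2 s n); exact: fin_num_measure.
by rewrite IH expectation_iid// -EFinD -natr1 mulrDl mul1r.
Qed.

Let cov0 i j : i != j -> covariance P (fW i) (fW j) = 0%E.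
Proof.
move=> ij; rewrite covarianceE ?fW1 ?Lfun2_mul_Lfun1//.
by rewrite expectation_prod_iid// !expectation_iid// EFinM subee.
Qed.

Lemma variance_sum_iid s n : injective s ->
  (('V_P[S s n])%E <= (n%:R * \int[Q]_x (f x ^+ 2))%:E)%E.
Proof.
move=> injs; elim: n => [|n IH].
  by rewrite mul0r S0 variance_cst.
rewrite SS varianceD//.
have covS m : (m <= n)%N -> covariance P (S s m) (fW (s n)) = 0%E.
  elim: m => [|m IHm] mn.
    by rewrite S0 covariance_cst_l.
  rewrite SS covarianceDl// IHm ?(ltnW mn)// add0e cov0//.
  by apply/eqP => /injs mE; rewrite mE ltnn in mn.
rewrite covS// mule0 adde0 -natr1 mulrDl mul1r EFinD leeD//.
rewrite varianceE// -(@expectation_iid (fun x => f x ^+ 2) (s n))//; last 2 first.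
- exact: measurable_funX.
- by move=> x; rewrite normrX exprn_ile1.
rewrite geeDl// oppe_le0; have := expectation_iid (s n) mf f1.
by rewrite /fW => ->; rewrite -EFin_expe lee_fin sqr_ge0.
Qed.

Lemma sum_iid_chebyshev (s : nat -> nat) n (t : R) : injective s -> 0 < t ->
  (P [set w | (t <= `|\sum_(i < n) f (W (s i) w) - n%:R * \int[Q]_x f x|)%R] <=
   (n%:R * (\int[Q]_x (f x ^+ 2)) / t ^+ 2)%:E)%E.
Proof.
move=> injs t0.
have mS : measurable_fun setT (S s n) by case/andP : (S2 s n) => /[!inE].
pose X : {RV P >-> R} := HB.pack (S s n) (isMeasurableFun.Build _ _ _ _ _ mS).
have := chebyshev X t0; rewrite expectation_sum_iid => /le_trans; apply.
rewrite (le_trans (lee_wpmul2l _ (variance_sum_iid n injs)))//.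
  by rewrite lee_fin invr_ge0 exprn_ge0// ltW.
by rewrite -EFinM mulrC.
Qed.

Lemma sum_iid_markov (s : nat -> nat) n (t : R) :
  injective s -> 0 < t -> (forall x, 0 <= f x) ->
  (P [set w | (t <= \sum_(i < n) f (W (s i) w))%R] <=
   (n%:R * (\int[Q]_x f x) / t)%:E)%E.
Proof.
move=> injs t0 f0.
have mS : measurable_fun setT (S s n) by case/andP : (S2 s n) => /[!inE].
pose X : {RV P >-> R} := HB.pack (S s n) (isMeasurableFun.Build _ _ _ _ _ mS).
have := @markov _ _ _ P X id t t0 (@measurable_id _ _ _) (fun _ => id)
  (fun x y _ _ => id).
have XE : id \o (fun x => `|x|) \o X = S s n.
  by apply/funext => w /=; rewrite ger0_norm// sumr_ge0.
rewrite XE expectation_sum_iid => H; rewrite EFinM lee_pdivlMr// muleC.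
apply: le_trans H; rewrite le_eqVlt; apply/orP; left; apply/eqP.
congr (_ * P _)%E; apply/seteqP; split=> w /=; rewrite lee_fin ger0_norm//;
  by rewrite sumr_ge0.
Qed.

End moments.

(** * Random signs and pair swaps *)

Section rademacher.
Context {R : realType}.

(** From exp(x) <= 1 / (1 - x), the left side is at most 2 / (1 - x ^ 2). The
    constant in the exponent is not optimal but suffices for bounded x. *)
Lemma cosh_le (x : R) : x ^+ 2 <= 2^-1 ->
  expR x + expR (- x) <= 2 * expR (2 * x ^+ 2).
Proof.
move=> x2.
have xlt1 : `|x| < 1.
  rewrite -(@expr_lt1 _ 2)// real_normK ?num_real//.
  by rewrite (le_lt_trans x2)// invf_lt1// ltr1n.
have /ltr_normlP[xgtN1 x_lt1] := xlt1.
have leV (y : R) : y < 1 -> expR y <= (1 - y)^-1.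
  move=> y1; rewrite -[y in leLHS]opprK expRN lef_pV2 ?posrE ?expR_gt0 ?subr_gt0//.
  exact: expR_ge1Dx.
have h1 := leV x x_lt1; have h2 := leV (- x) xgtN1.
rewrite (le_trans (lerD h1 h2))// opprK.
have d1 : 0 < 1 - x by rewrite subr_gt0.
have d2 : 0 < 1 + x by rewrite -[x]opprK subr_gt0.
have d3 : 0 < 1 - x ^+ 2.
  by rewrite (_ : 1 - _ = (1 - x) * (1 + x)) ?mulr_gt0//; ring.
have -> : (1 - x)^-1 + (1 + x)^-1 = 2 / (1 - x ^+ 2).
  by field; rewrite !gt_eqF.
rewrite ler_pM2l//.
apply: (@le_trans _ _ (1 + 2 * x ^+ 2)); last exact: expR_ge1Dx.
rewrite -div1r ler_pdivrMr//.
have := sqr_ge0 x; nra.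
Qed.

Definition sign (b : bool) : R := if b then -1 else 1.

(** The sum over all sign vectors factors over the coordinates. *)
Lemma rademacher_mgf n (u : 'I_n -> R) l : (forall i, (l * u i) ^+ 2 <= 2^-1) ->
  \sum_(s : {ffun 'I_n -> bool}) expR (l * \sum_i sign (s i) * u i) <=
  2 ^+ n * expR (2 * l ^+ 2 * \sum_i u i ^+ 2).
Proof.
move=> lu.
under eq_bigr do rewrite mulr_sumr expR_sum.
rewrite -(bigA_distr_bigA (fun i b => expR (l * (sign b * u i)))).
rewrite mulr_sumr expR_sum.
have -> : 2 ^+ n = \prod_(i < n) (2 : R) by rewrite prodr_const card_ord.
rewrite -big_split/=; apply: ler_prod => i _.
rewrite sumr_ge0/= => [|b _]; last exact: expR_ge0.
rewrite big_bool/= mulN1r mul1r mulrN addrC.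
by rewrite -mulrA -exprMn cosh_le.
Qed.

(** Chernoff's bound for a self-normalized Rademacher sum. Because the threshold
    contains V, which dominates the variance, the fixed parameter [l = g / 4]
    makes the variance term cancel and leaves a bound in A alone. *)
Lemma rademacher_count n (u : 'I_n -> R) (V A g : R) :
  (forall i, `|u i| <= 2) -> \sum_i u i ^+ 2 <= 2 * V -> 0 < g <= 1 ->
  #|[set s : {ffun 'I_n -> bool} |
      g * (V + A) < `|\sum_i sign (s i) * u i|]%SET|%:R <=
  2 ^+ n * (2 * expR (- (g ^+ 2 * A / 4))).
Proof.
move=> u2 uV /andP[g0 g1]; pose l := g / 4.
have l0 : 0 < l by rewrite divr_gt0.
have lu i : (l * u i) ^+ 2 <= 2^-1.
  rewrite exprMn; have ui : u i ^+ 2 <= 4.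
    by rewrite -(real_normK (num_real _)) -[4]/(2 * 2)%:R natrM -expr2 lerXn2r ?nnegrE.
  have l2 : l ^+ 2 <= 16^-1.
    have -> : 16^-1 = (4^-1 : R) ^+ 2 by field.
    rewrite lerXn2r ?nnegrE ?invr_ge0 ?(ltW l0)//.
    by rewrite /l ler_pdivrMr// mulVf.
  rewrite (le_trans (ler_pM (sqr_ge0 _) (sqr_ge0 _) l2 ui))//; lra.
have lu' i : (- l * u i) ^+ 2 <= 2^-1 by rewrite mulNr sqrrN.
pose S (s : {ffun 'I_n -> bool}) := \sum_i sign (s i) * u i.
rewrite cardE -sum1_size natr_sum big_enum/=.
apply: (@le_trans _ _ (\sum_(s : {ffun 'I_n -> bool})
    (expR (l * S s) + expR (- l * S s)) * expR (- (l * (g * (V + A)))))).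
  rewrite big_mkcond/=; apply: ler_sum => s _; rewrite inE; case: ifPn => [gS|_].
    rewrite mulrDl.
    have [S0|S0] := leP 0 (S s).
      have: 1 <= expR (l * S s) * expR (- (l * (g * (V + A)))).
        rewrite -expRD -expR0 ler_expR -mulrBr mulr_ge0 ?ltW// subr_gt0.
        by rewrite -(ger0_norm S0).
      by have := mulr_ge0 (expR_ge0 (- l * S s)) (expR_ge0 (- (l * (g * (V + A))))); lra.
    have: 1 <= expR (- l * S s) * expR (- (l * (g * (V + A)))).
      rewrite -expRD -expR0 ler_expR mulNr -mulrN -mulrBr mulr_ge0 ?ltW// subr_gt0.
      by rewrite -(ltr0_norm S0).
    by have := mulr_ge0 (expR_ge0 (l * S s)) (expR_ge0 (- (l * (g * (V + A))))); lra.
  by rewrite mulr_ge0 ?addr_ge0 ?expR_ge0.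
rewrite -mulr_suml big_split/=.
apply: (@le_trans _ _ ((2 ^+ n * expR (4 * l ^+ 2 * V) +
    2 ^+ n * expR (4 * l ^+ 2 * V)) * expR (- (l * (g * (V + A)))))).
  rewrite ler_wpM2r ?expR_ge0// lerD//.
    rewrite (le_trans (rademacher_mgf lu))// ler_wpM2l ?exprn_ge0// ler_expR.
    by have := ler_wpM2l (sqr_ge0 l) uV; lra.
  rewrite (le_trans (rademacher_mgf lu'))// ler_wpM2l ?exprn_ge0// ler_expR sqrrN.
  by have := ler_wpM2l (sqr_ge0 l) uV; lra.
have aux (p e x : R) : (p * e + p * e) * x = p * (2 * (e * x)) by ring.
rewrite aux ler_pM2l ?exprn_gt0// ler_pM2l// -expRD ler_expR.
by rewrite /l le_eqVlt; apply/orP; left; apply/eqP; field.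
Qed.

End rademacher.

Section swaps.
Context {R : realType} (T : Type).

(** The involution of the indices that exchanges 2i and 2i+1 for those i < n
    with [s i]. *)
Definition swap_pairs n (s : {ffun 'I_n -> bool}) (j : nat) : nat :=
  if insub j./2 is Some i then
    if s i then (if odd j then j.-1 else j.+1) else j
  else j.

Lemma swap_pairsK n (s : {ffun 'I_n -> bool}) : involutive (swap_pairs s).
Proof.
have half_flip j : (if odd j then j.-1 else j.+1)./2 = j./2.
  case: ifPn => oj; last by rewrite /= uphalf_half (negbTE oj).
  by case: j oj => //= j; rewrite uphalf_half => /negbTE ->.
move=> j; case E : (insub j./2 : option 'I_n) => [i|]; last first.
  have H : swap_pairs s j = j by rewrite /swap_pairs E.
  by rewrite !H.
case si : (s i); last first.
  have H : swap_pairs s j = j by rewrite /swap_pairs E si.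
  by rewrite !H.
have -> : swap_pairs s j = if odd j then j.-1 else j.+1.
  by rewrite /swap_pairs E si.
rewrite /swap_pairs half_flip E si.
case oj : (odd j); last by rewrite /= oj.
by case: j oj {E} => //= j /negbTE ->.
Qed.

Lemma swap_pairs_even n (s : {ffun 'I_n -> bool}) (i : 'I_n) :
  swap_pairs s i.*2 = if s i then i.*2.+1 else i.*2.
Proof. by rewrite /swap_pairs doubleK valK odd_double. Qed.

Lemma swap_pairs_odd n (s : {ffun 'I_n -> bool}) (i : 'I_n) :
  swap_pairs s i.*2.+1 = if s i then i.*2 else i.*2.+1.
Proof. by rewrite /swap_pairs /= uphalf_double valK odd_double. Qed.

Lemma sum_double (F : nat -> R) n :
  \sum_(j < n.*2) F j = \sum_(i < n) (F i.*2 + F i.*2.+1).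
Proof.
elim: n => [|n IH]; first by rewrite !big_ord0.
by rewrite doubleS !big_ord_recr/= IH addrA.
Qed.

Variable f : nat -> T -> R.
Variables (n : nat) (a b : R).

(** The samples at even and at odd indices disagree on the k-th function by more
    than their joint second moment allows. The right-hand scale is invariant
    under the swaps, the left-hand side changes only by signs. *)
Definition pair_deviation (k : nat) : set (nat -> T) := [set z |
  b * (\sum_(i < n) (f k (z i.*2) ^+ 2 + f k (z i.*2.+1) ^+ 2) + n%:R * a) <
  `|\sum_(i < n) (f k (z i.*2) - f k (z i.*2.+1))|].

(** The class restricted to the 2n points of [z] has an l1-cover by N vectors.
    The radius is small enough that replacing a function by a center costs only
    half of the threshold in [pair_deviation]. *)
Definition covered N (z : nat -> T) :=
  exists c : 'I_N -> nat -> R, (forall j i, `|c j i| <= 1) /\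
    forall k, exists j,
      \sum_(i < n.*2) `|f k (z i) - c j i| <= n%:R * (b * a / 4).

Hypothesis f1 : forall k x, `|f k x| <= 1.
Hypothesis a0 : 0 <= a.
Hypothesis b0 : 0 < b <= 2^-1.

(** For fixed [z], the bad swaps are among those for which one of the N centers
    has a large Rademacher sum. *)
Lemma swap_count N z : covered N z ->
  #|[set s : {ffun 'I_n -> bool} |
     `[< exists k, pair_deviation k (z \o swap_pairs s) >]]%SET|%:R <=
  2 ^+ n * (N%:R * (2 * expR (- (b ^+ 2 * (n%:R * a) / 16)))).
Proof.
move=> [c [c1 fc]]; have /andP[bgt0 b2] := b0.
pose V j := \sum_(i < n) (c j i.*2 ^+ 2 + c j i.*2.+1 ^+ 2).
pose bad j := [set s : {ffun 'I_n -> bool} |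
  b / 2 * (V j + n%:R * a) <
   `|\sum_(i < n) sign (s i) * (c j i.*2 - c j i.*2.+1)|]%SET.
apply: (@le_trans _ _ (#|\bigcup_j bad j|%:R)%SET).
  rewrite ler_nat; apply: subset_leq_card; apply/fintype.subsetP => s.
  rewrite inE => /asboolP[k ks]; have [j fcj] := fc k.
  apply/finset.bigcupP; exists j => //; rewrite inE.
  move: ks; rewrite /pair_deviation/=.
  under eq_bigr do rewrite swap_pairs_even swap_pairs_odd.
  under [X in _ < `|X|]eq_bigr do rewrite swap_pairs_even swap_pairs_odd.
  have -> : \sum_(i < n) (f k (z (if s i then i.*2.+1 else i.*2)) ^+ 2 +
      f k (z (if s i then i.*2 else i.*2.+1)) ^+ 2) =
      \sum_(i < n) (f k (z i.*2) ^+ 2 + f k (z i.*2.+1) ^+ 2).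
    by apply: eq_bigr => i _; case: (s i) => //; rewrite addrC.
  have -> : \sum_(i < n) (f k (z (if s i then i.*2.+1 else i.*2)) -
      f k (z (if s i then i.*2 else i.*2.+1))) =
      \sum_(i < n) sign (s i) * (f k (z i.*2) - f k (z i.*2.+1)).
    by apply: eq_bigr => i _; rewrite /sign; case: (s i);
      rewrite ?mul1r ?mulN1r ?opprB.
  set F := \sum_(i < n) sign _ * _; set VF := \sum_(i < n) (_ + _).
  set C := \sum_(i < n) sign _ * _.
  rewrite (sum_double (fun i => `|f k (z i) - c j i|)) in fcj.
  have FC : `|F - C| <= n%:R * (b * a / 4).
    rewrite (le_trans _ fcj)// /F /C -sumrB (le_trans (ler_norm_sum _ _ _))//.
    apply: ler_sum => i _; rewrite -mulrBr normrM.
    have -> : `|sign (s i) : R| = 1 by rewrite /sign; case: (s i); rewrite ?normrN normr1.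
    rewrite mul1r opprB addrACA [- _ + _]addrC addrC [leRHS]addrC.
    rewrite [X in `|X|](_ : _ = (f k (z i.*2) - c j i.*2) -
      (f k (z i.*2.+1) - c j i.*2.+1)); last by ring.
    by rewrite (le_trans (ler_normB _ _))// addrC.
  have VFC : `|VF - V j| <= 2 * (n%:R * (b * a / 4)).
    rewrite (le_trans _ (ler_wpM2l _ fcj))// /VF /V -sumrB mulr_sumr.
    rewrite (le_trans (ler_norm_sum _ _ _))//; apply: ler_sum => i _.
    have sq (p q : R) : `|p| <= 1 -> `|q| <= 1 -> `|p ^+ 2 - q ^+ 2| <= 2 * `|p - q|.
      move=> p1 q1; rewrite subr_sqr normrM mulrC ler_wpM2r//.
      by rewrite (le_trans (ler_normD _ _))// [leRHS](_ : _ = 1 + 1) ?lerD.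
    rewrite mulrDr [X in `|X|](_ : _ = (f k (z i.*2) ^+ 2 - c j i.*2 ^+ 2) +
      (f k (z i.*2.+1) ^+ 2 - c j i.*2.+1 ^+ 2)); last by ring.
    by rewrite (le_trans (ler_normD _ _))// lerD// sq.
  have : `|F| <= `|C| + `|F - C| by rewrite -{1}(subrK C F) addrC (le_trans (ler_normD _ _)).
  move: VFC; rewrite ler_norml => /andP[VFC _].
  have na0 : 0 <= n%:R * a by rewrite mulr_ge0.
  have bV : 0 <= b * V j.
    rewrite mulr_ge0 ?(ltW bgt0)//.
    by apply: sumr_ge0 => i _; rewrite addr_ge0 ?sqr_ge0.
  move: FC VFC na0 bV; move: (`|F|) (`|C|) (`|F - C|) => F' C' D.
  move: (V j) => V' FC VFC na0 bV FCD bF.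
  have : b * VF >= b * (V' - 2 * (n%:R * (b * a / 4))).
    by rewrite ler_wpM2l ?(ltW bgt0)//; lra.
  have : b * (b * (n%:R * a)) <= 2^-1 * (b * (n%:R * a)).
    by rewrite ler_wpM2r// mulr_ge0// ltW.
  by lra.
apply: (@le_trans _ _ (\sum_(j < N) #|bad j|%:R)).
  rewrite -natr_sum ler_nat.
  elim/big_rec2 : _ => [|j m B _ IH]; first by rewrite cards0.
  by rewrite (leq_trans (leq_card_setU _ _).1)// leq_add2l.
rewrite [leRHS](_ : _ = \sum_(j < N)
    2 ^+ n * (2 * expR (- (b ^+ 2 * (n%:R * a) / 16)))); last first.
  by rewrite sumr_const card_ord -[RHS]mulr_natl mulrCA.
apply: ler_sum => j _.
have -> : b ^+ 2 * (n%:R * a) / 16 = (b / 2) ^+ 2 * (n%:R * a) / 4 by field.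
apply: rademacher_count; last by apply/andP; split; lra.
- by move=> i; rewrite (le_trans (ler_normB _ _))// [leRHS](_ : _ = 1 + 1) ?lerD.
rewrite /V mulr_sumr; apply: ler_sum => i _.
by have := sqr_ge0 (c j i.*2 + c j i.*2.+1); lra.
Qed.

End swaps.

(** * The relative deviation inequality *)

Section relative_deviation.
Context {R : realType} d (Omega : measurableType d) d' (T : measurableType d').
Variables (P : probability Omega R) (W : nat -> {RV P >-> T}).
Hypothesis W_iid : iid P W.
Let Q := distribution P (W 0%N).
Variables (f : nat -> T -> R).
Hypothesis mf : forall k, measurable_fun setT (f k).
Hypothesis f1 : forall k x, `|f k x| <= 1.
Variables (n : nat) (a e : R).

Let q1 k := n%:R * \int[Q]_x f k x.
Let q2 k := n%:R * \int[Q]_x (f k x ^+ 2).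

(** The event to be excluded; its threshold contains the empirical second moment
    so that it can be compared with the threshold of [pair_deviation]. *)
Definition relative_deviation k : set (nat -> T) := [set x : nat -> T |
  e * (n%:R * \int[Q]_x (f k x ^+ 2) + \sum_(i < n) f k (x i) ^+ 2 + n%:R * a) <
  `|\sum_(i < n) f k (x i) - n%:R * \int[Q]_x f k x|].

(** A sample that behaves well with respect to the k-th function. An independent
    copy of the sample is in this event with probability at least 1/2, and then
    deviates from any sample in [relative_deviation k]. *)
Let ghost k : set (nat -> T) := [set y : nat -> T |
  `|\sum_(i < n) f k (y i) - q1 k| < e / 2 * (q2 k + n%:R * a)] `&`
  [set y : nat -> T | \sum_(i < n) f k (y i) ^+ 2 < 4 * q2 k + n%:R * a].

Let measurable_term k i :
  measurable_fun setT (fun x : seq_space T => f k (x i)).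
Proof. by apply: measurableT_comp (measurable_coordinate i). Qed.

Let measurable_lt (g h : seq_space T -> R) : measurable_fun setT g ->
  measurable_fun setT h -> measurable [set x | g x < h x].
Proof.
move=> mg mh; rewrite -[X in measurable X]setTI.
by apply: (@measurable_fun_ltr _ _ _ _ g h) => //.
Qed.

Lemma relative_deviation_measurable k :
  measurable (relative_deviation k : set (seq_space T)).
Proof.
apply: measurable_lt.
  apply: measurable_funM => //; apply: measurable_funD => //.
  apply: measurable_funD => //; apply: measurable_sum => i.
  exact: measurable_funX.
apply: measurableT_comp => //; apply: measurable_funB => //.
exact: measurable_sum.
Qed.

Let ghost_measurable k : measurable (ghost k : set (seq_space T)).
Proof.
apply: measurableI; apply: measurable_lt => //.
  apply: measurableT_comp => //; apply: measurable_funB => //.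
  exact: measurable_sum.
by apply: measurable_sum => i; exact: measurable_funX.
Qed.

Let pair_deviation_measurable b k :
  measurable (pair_deviation f n a b k : set (seq_space T)).
Proof.
apply: measurable_lt.
  apply: measurable_funM => //; apply: measurable_funD => //.
  by apply: measurable_sum => i; apply: measurable_funD; exact: measurable_funX.
apply: measurableT_comp => //; apply: measurable_sum => i.
exact: measurable_funB.
Qed.

Hypothesis a0 : 0 < a.
Hypothesis e01 : 0 < e <= 1.
Hypothesis na_large : 16 <= e ^+ 2 * (n%:R * a).

Let q2_ge0 k : 0 <= q2 k.
Proof. by rewrite mulr_ge0// Rintegral_ge0// => x _; exact: sqr_ge0. Qed.

Let na0 : 0 < n%:R * a.
Proof.
have /andP[e0 _] := e01.
rewrite -(pmulr_rgt0 _ (exprn_gt0 2 e0)); exact: lt_le_trans na_large.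
Qed.

(** Chebyshev's inequality bounds the failure of the first condition by 1/4, as
    n a e ^ 2 >= 16, and Markov's inequality that of the second one. *)
Let ghost_half k s : injective s ->
  (2^-1%:E <= P (subsample W s @^-1` ghost k))%E.
Proof.
move=> injs; have /andP[e0 e1] := e01.
have q20 := q2_ge0 k.
pose B1 : set (seq_space T) := [set y |
  e / 2 * (q2 k + n%:R * a) <= `|\sum_(i < n) f k (y i) - q1 k|].
pose B2 : set (seq_space T) := [set y |
  4 * q2 k + n%:R * a <= \sum_(i < n) f k (y i) ^+ 2].
have ghostE : ghost k = ~` (B1 `|` B2).
  rewrite setCU; congr (_ `&` _); apply/seteqP; split=> y /=;
    by rewrite ltNge => /negP.
have mB : measurable (B1 `|` B2).
  by rewrite -[X in measurable X]setCK; apply: measurableC; rewrite -ghostE.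
have mB1 : measurable B1.
  rewrite -[X in measurable X]setCK; apply: measurableC.
  have -> : ~` B1 = [set y | `|\sum_(i < n) f k (y i) - q1 k| < e / 2 * (q2 k + n%:R * a)].
    by apply/seteqP; split=> y /=; rewrite ltNge => /negP.
  apply: measurable_lt => //.
  apply: measurableT_comp => //; apply: measurable_funB => //.
  exact: measurable_sum.
have mB2 : measurable B2.
  rewrite -[X in measurable X]setCK; apply: measurableC.
  have -> : ~` B2 = [set y | \sum_(i < n) f k (y i) ^+ 2 < 4 * q2 k + n%:R * a].
    by apply/seteqP; split=> y /=; rewrite ltNge => /negP.
  apply: measurable_lt => //.
  by apply: measurable_sum => i; exact: measurable_funX.
have t0 : 0 < q2 k + n%:R * a by rewrite ltr_wpDl.
have PB1 : (P (subsample W s @^-1` B1) <= 4^-1%:E)%E.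
  have := sum_iid_chebyshev W_iid (mf k) (f1 k) n injs
    (mulr_gt0 (divr_gt0 e0 (ltr0Sn _ 1)) t0).
  move=> /le_trans; apply; rewrite lee_fin -/(q2 k).
  rewrite ler_pdivrMr ?exprn_gt0 ?mulr_gt0 ?divr_gt0//.
  have -> : 4^-1 * (e / 2 * (q2 k + n%:R * a)) ^+ 2 =
    16^-1 * (e ^+ 2 * (q2 k + n%:R * a)) * (q2 k + n%:R * a) by field.
  apply: (@le_trans _ _ (q2 k + n%:R * a)); first by rewrite lerDl ltW.
  rewrite ler_peMl ?(ltW t0)// mulrC ler_pdivlMr// mul1r (le_trans na_large)//.
  by rewrite ler_wpM2l ?sqr_ge0// lerDr.
have PB2 : (P (subsample W s @^-1` B2) <= 4^-1%:E)%E.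
  have t1 : 0 < 4 * q2 k + n%:R * a by rewrite ltr_wpDl// mulr_ge0.
  have mf2 : measurable_fun setT (fun x => f k x ^+ 2) by exact: measurable_funX.
  have f21 x : `|f k x ^+ 2| <= 1 by rewrite normrX exprn_ile1.
  have := sum_iid_markov W_iid mf2 f21 n injs t1 (fun x => sqr_ge0 _).
  move=> /le_trans; apply; rewrite lee_fin -/(q2 k).
  by rewrite ler_pdivrMr// mulrC ler_pdivlMr//; have := na0; lra.
have -> : 2^-1 = 1 - (4^-1 + 4^-1) :> R by field.
rewrite EFinB EFinD ghostE -preimage_setC probability_setC; last first.
  exact: subsample_preimage_measurable.
rewrite leeB// (le_trans _ (leeD PB1 PB2))// preimage_setU.
by apply: measureU2; exact: subsample_preimage_measurable.
Qed.

Let ghost_symmetrize k (x y : nat -> T) (z : nat -> T) :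
  (forall i, z i.*2 = x i) -> (forall i, z i.*2.+1 = y i) ->
  relative_deviation k x -> ghost k y -> pair_deviation f n a (e / 8) k z.
Proof.
move=> zx zy; rewrite /relative_deviation /ghost /pair_deviation/=.
under [X in _ -> _ -> _ * (X + _) < _]eq_bigr do rewrite zx zy.
under [X in _ -> _ -> _ < `|X|]eq_bigr do rewrite zx zy.
rewrite big_split/= sumrB -/(q1 k) -/(q2 k).
move: (\sum_(i < n) f k (x i)) (\sum_(i < n) f k (y i)) => X Y.
have y0 : 0 <= \sum_(i < n) f k (y i) ^+ 2 by apply: sumr_ge0 => i _; exact: sqr_ge0.
have x0 : 0 <= \sum_(i < n) f k (x i) ^+ 2 by apply: sumr_ge0 => i _; exact: sqr_ge0.
move: x0 y0.
move: (\sum_(i < n) f k (x i) ^+ 2) (\sum_(i < n) f k (y i) ^+ 2) => X2 Y2.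
move=> x0 y0 dev [g1 g2]; have /andP[e0 e1] := e01.
have : `|X - q1 k| <= `|X - Y| + `|Y - q1 k|.
  by rewrite (le_trans _ (ler_normD _ _))// addrA subrK.
move: g1 dev g2; move: (`|X - q1 k|) (`|X - Y|) (`|Y - q1 k|) => A B C.
have na_gt0 := na0; have := q2_ge0 k.
move: (q2 k) (n%:R * a) na_gt0 => q na na_gt0 q_ge0 g1 dev g2 ABC.
have h1 := mulr_ge0 (ltW e0) x0.
have h2 : e * Y2 <= e * (4 * q + na) by rewrite ler_wpM2l// ltW.
have h3 := mulr_gt0 e0 na_gt0.
have h4 := mulr_ge0 (ltW e0) q_ge0.
by lra.
Qed.

(** By exchangeability the event has the same probability after each of the
    2 ^ n swaps; averaging over them reduces the claim to the pointwise count
    [swap_count]. *)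
Lemma swap_probability N b : 0 < b <= 2^-1 ->
  (forall z, covered f n a b N z) ->
  (P (subsample W id @^-1` \bigcup_k pair_deviation f n a b k) <=
   (N%:R * (2 * expR (- (b ^+ 2 * (n%:R * a) / 16))))%:E)%E.
Proof.
move=> b0 cov; set c := N%:R * _.
pose E : set (seq_space T) := \bigcup_k pair_deviation f n a b k.
have mE : measurable E by apply: bigcupT_measurable.
pose A (s : {ffun 'I_n -> bool}) := subsample W (swap_pairs s) @^-1` E.
have mA s : measurable (A s) by exact: subsample_preimage_measurable.
have PA s : P (A s) = P (subsample W id @^-1` E).
  by apply: (subsample_law W_iid) => //; exact: inv_inj (swap_pairsK s).
have PE : P (subsample W id @^-1` E) = (fine (P (subsample W id @^-1` E)))%:E.
  rewrite fineK// fin_num_measure//; exact: subsample_preimage_measurable.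
have sumA : (\sum_(s : {ffun 'I_n -> bool}) P (A s) =
    (2 ^+ n * fine (P (subsample W id @^-1` E)))%:E)%E.
  under eq_bigr do rewrite PA PE.
  by rewrite sumEFin sumr_const card_ffun card_bool card_ord -natrX mulr_natl.
rewrite -/E PE lee_fin -(ler_pM2l (exprn_gt0 n (ltr0Sn R 1))) -lee_fin -sumA.
rewrite [leLHS](_ : _ =
    (\int[P]_w (\sum_(s : {ffun 'I_n -> bool}) (\1_(A s) w)%:E)%E)%E); last first.
  rewrite ge0_integral_sum//=; last by move=> s; exact/measurable_EFinP.
  by apply: eq_bigr => s _; rewrite integral_indic// setIT.
rewrite -[leRHS]mule1 -(probability_setT P) -integral_cst//.
apply: ge0_le_integral => //.
- by move=> w _; apply: sume_ge0 => s _; rewrite lee_fin.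
- apply: emeasurable_sum => s; exact/measurable_EFinP.
move=> w _; rewrite sumEFin lee_fin.
have := swap_count f1 (ltW a0) b0 (cov (subsample W id w)).
apply: le_trans; rewrite cardE -sum1_size natr_sum big_enum/=.
rewrite [leRHS]big_mkcond/=; apply: ler_sum => s _.
rewrite indicE inE; case: asboolP => [_|sE]; first by case: (w \in A s).
by rewrite (_ : w \in A s = false)//; apply/negbTE/negP => /set_mem [k _ wk];
  apply: sE; exists k.
Qed.

(** Let the sample occupy the even indices and an independent copy the odd ones.
    If k is the first function for which the sample deviates, then with
    conditional probability at least 1/2 the copy is good for this k, and the
    pair deviates. Splitting according to the first k is what lets the copy be
    tested against a single function. *)
Lemma relative_deviation_probability N s : injective s ->
  (forall z, covered f n a (e / 8) N z) ->
  (P (subsample W s @^-1` \bigcup_k relative_deviation k) <=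
   (4 * N%:R * expR (- ((e / 8) ^+ 2 * (n%:R * a) / 16)))%:E)%E.
Proof.
move=> injs cov; have /andP[e0 e1] := e01.
pose D : set (seq_space T) := \bigcup_k relative_deviation k.
have mrd := relative_deviation_measurable.
have mD : measurable D by exact: bigcupT_measurable.
have injd : injective double by move=> i j /(congr1 half); rewrite !doubleK.
have injd1 : injective (fun i => i.*2.+1).
  by move=> i j /(congr1 half); rewrite /= !uphalf_double.
pose F k : set (seq_space T) := seqDU (fun k => relative_deviation k) k.
have mF k : measurable (F k).
  apply: measurableD => //; apply: bigsetU_measurable => j _; exact: mrd.
pose U := subsample W double; pose V := subsample W (fun i => i.*2.+1).
have mUV k : measurable (U @^-1` F k `&` V @^-1` ghost k).
  by apply: measurableI; exact: subsample_preimage_measurable.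
have tF : trivIset setT (fun k => U @^-1` F k).
  move=> i j _ _ [w [Fi Fj]].
  by apply: (@trivIset_seqDU _ (fun k => relative_deviation k)) => //; exists (U w).
rewrite -/D (subsample_law W_iid injs mD) -(subsample_law W_iid injd mD).
have -> : subsample W double @^-1` D = \bigcup_k (U @^-1` F k).
  by rewrite -preimage_bigcup /D seqDU_bigcup_eq.
rewrite measure_bigcup//; last first.
  by move=> k _; exact: subsample_preimage_measurable.
have half : (\sum_(k <oo | k \in [set: nat]) P (U @^-1` F k) <=
   2%:E * \sum_(k <oo | k \in [set: nat]) P (U @^-1` F k `&` V @^-1` ghost k))%E.
  rewrite -nneseriesZl//; apply: lee_nneseries => // k _.
  rewrite (subsamples_indep W_iid)//; last first.
    by move=> i j; apply/eqP => /(congr1 odd); rewrite /= !odd_double.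
  rewrite muleCA -[leLHS]mule1 lee_wpmul2l//.
  rewrite -lee_pdivrMl// mule1; exact: ghost_half.
apply: (le_trans half); rewrite -measure_bigcup//; last first.
  move=> i j _ _ [w [[Fi _] [Fj _]]].
  by apply: tF => //; exists w.
have -> : 4 * N%:R * expR (- ((e / 8) ^+ 2 * (n%:R * a) / 16)) =
  2 * (N%:R * (2 * expR (- ((e / 8) ^+ 2 * (n%:R * a) / 16)))) by ring.
rewrite EFinM lee_wpmul2l//.
have e8 : 0 < e / 8 <= 2^-1 by apply/andP; split; lra.
rewrite (le_trans _ (swap_probability e8 cov))// le_measure// ?inE.
- exact: bigcupT_measurable.
- apply: subsample_preimage_measurable; exact: bigcupT_measurable.
move=> w [k _ [Fk Gk]]; exists k => //.
by apply: (@ghost_symmetrize k (U w) (V w)) => //; exact: subset_seqDU Fk.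
Qed.

End relative_deviation.

(** * Finite covers of the kernel class *)

Lemma measurable_reflect {R : realType} n (c : R) (z : 'rV[R]_n) :
  measurable_fun setT (fun x : 'rV[R]_n => c *: (z - x)).
Proof.
apply/measurable_fun_rVP => i; under eq_fun do rewrite !mxE.
by apply: measurable_funM => //; apply: measurable_funB => //; exact: measurable_coord.
Qed.

Section empirical_measure.
Context {R : realType} d (T : measurableType d).
Variables (x : nat -> T) (m : nat).

Let w0 : 0 <= (m.+1%:R : R)^-1. Proof. by rewrite invr_ge0. Qed.

Definition empirical_measure : set T -> \bar R :=
  mscale (NngNum w0) (msum (fun i => \d_(x i)) m.+1).

HB.instance Definition _ := Measure.on empirical_measure.

Let empirical_measureT : empirical_measure setT = 1%E.
Proof.
rewrite /empirical_measure /mscale/= /msum/=.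
under eq_bigr do rewrite diracT.
by rewrite sumEFin sumr_const card_ord -EFinM mulVf.
Qed.

HB.instance Definition _ :=
  Measure_isProbability.Build _ _ _ empirical_measure empirical_measureT.

Lemma integral_empirical (f : T -> R) : measurable_fun setT f ->
  (forall t, 0 <= f t) ->
  (\int[empirical_measure]_t (f t)%:E = (m.+1%:R^-1 * \sum_(i < m.+1) f (x i))%:E)%E.
Proof.
move=> mf f0; have mEf : measurable_fun setT (EFin \o f) by exact/measurable_EFinP.
rewrite ge0_integral_mscale//; last by move=> t _; rewrite lee_fin.
rewrite ge0_integral_measure_sum//; last by move=> t _; rewrite lee_fin.
under eq_bigr do rewrite integral_dirac// diracT mul1e.
by rewrite sumEFin -EFinM.
Qed.

(** Averaged over the points, 2 r |g - h| <= |g - h|^2 + r^2. *)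
Lemma L2_dist_empirical (g h : T -> R) (r : R) : measurable_fun setT g ->
  measurable_fun setT h -> 0 < r ->
  (L2_dist empirical_measure g h < r%:E)%E ->
  \sum_(i < m.+1) `|g (x i) - h (x i)| <= m.+1%:R * r.
Proof.
move=> mg mh r0; rewrite /L2_dist unlock/=.
under eq_integral => t _ do rewrite /= powR_mulrn// real_normK ?num_real//.
rewrite integral_empirical; last 2 first.
- by apply: measurable_funX; exact: measurable_funB.
- by move=> t; exact: sqr_ge0.
rewrite poweR_EFin lte_fin powR12_sqrt; last first.
  by rewrite mulr_ge0// sumr_ge0// => i _; exact: sqr_ge0.
rewrite -(ger0_norm (ltW r0)) -sqrtr_sqr ltr_sqrt ?exprn_gt0//.
rewrite sqrtr_sqr ger0_norm ?(ltW r0)//.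
rewrite mulrC ltr_pdivrMr// => S2.
rewrite -(ler_pM2r r0) mulr_suml.
apply: (@le_trans _ _ (\sum_(i < m.+1) 2^-1 * ((g (x i) - h (x i)) ^+ 2 + r ^+ 2))).
  apply: ler_sum => i _; rewrite -(real_normK (num_real (g (x i) - h (x i)))).
  by have := sqr_ge0 (`|g (x i) - h (x i)| - r); lra.
rewrite -mulr_sumr big_split/= sumr_const card_ord -mulr_natl; lra.
Qed.

End empirical_measure.

Section kernel_cover.
Context {R : realType} {d : nat} (K : 'rV[R]_d -> R).
Hypothesis K_regular : regular_kernel K.

Let kappa := fine (sup_abs K).

Lemma kernel_le_sup s : `|K s| <= kappa.
Proof.
have H : (`|K s|%:E <= sup_abs K)%E by apply: ereal_sup_ubound; exists s.
rewrite -lee_fin fineK// ge0_fin_numE; first exact: kernel_bounded.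
by rewrite (le_trans _ H).
Qed.

(** A kernel of integral 1 cannot vanish identically. *)
Lemma kernel_sup_gt0 : 0 < kappa.
Proof.
rewrite lt_neqAle; apply/andP; split; last first.
  by rewrite (le_trans _ (kernel_le_sup 0)).
apply/eqP => k0; have := kernel_integral K_regular.
rewrite integral0_eq; first by move=> /esym/eqP; rewrite onee_eq0.
move=> s _; have := kernel_le_sup s; rewrite -k0 normr_le0 => /eqP ->//.
Qed.

Lemma rescale_le_sup h x z : `|rescale K h x z| <= kappa.
Proof. exact: kernel_le_sup. Qed.

Lemma measurable_rescale h x : measurable_fun setT (rescale K h x).
Proof.
apply: (measurableT_comp (kernel_measurable K_regular)).
exact: measurable_reflect.
Qed.

Lemma kernel_class_bounded g : kernel_class K g ->
  measurable_fun setT g /\ forall x, `|g x| <= kappa.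
Proof.
move=> [h [x [_ ->]]]; split; first exact: measurable_rescale.
exact: rescale_le_sup.
Qed.

(** Centers of a cover need not be bounded, but truncating them to the range of
    the class does not increase any distance. *)
Lemma truncate_closer (c u v : R) : `|u| <= c ->
  `|u - Num.max (- c) (Num.min c v)| <= `|u - v|.
Proof.
rewrite ler_norml => /andP[cu uc].
rewrite /Num.max /Num.min.
case: (ltP c v) => cv.
  by case: ltP => ?; rewrite !ler0_norm ?subr_le0; lra.
case: ltP => // vc.
by rewrite !ger0_norm ?subr_ge0; lra.
Qed.

(** The covering condition applied to the empirical measure of the points. The
    added 1 leaves room to choose an actual cover, whose size exceeds the
    infimum by less than that. *)
Lemma kernel_cover : exists C nu : R, [/\ 0 < C, 0 < nu &
  forall (eta : R) (x : nat -> 'rV[R]_d) m, 0 < eta < 1 ->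
  exists N (c : 'I_N -> 'rV[R]_d -> R), [/\ N%:R <= C * eta `^ (- nu) + 1,
    forall j z, `|c j z| <= kappa &
    forall g, kernel_class K g -> exists j,
      \sum_(i < m.+1) `|g (x i) - c j (x i)| <= m.+1%:R * (kappa * eta)]].
Proof.
have [C [nu [C0 nu0 H]]] := kernel_covering K_regular.
exists C, nu; split=> // eta x m eta01.
have /andP[eta0 eta1] := eta01.
pose E : probability 'rV[R]_d R := empirical_measure x m.
have /H := eta01 => {}H.
have : (covering_number E (kappa * eta) (kernel_class K) <
    (C * eta `^ (- nu) + 1)%:E)%E.
  apply: (@le_lt_trans _ _ (C * eta `^ (- nu))%:E).
    by apply: le_trans H; apply: ereal_sup_ubound; exists E.
  by rewrite lte_fin ltrDl.
move=> /ereal_inf_lt[_ [N [c [cL cov]] <-]]; rewrite lte_fin => NC.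
exists N, (fun j z => Num.max (- kappa) (Num.min kappa (c j z))); split.
- exact: ltW.
- have k0 := kernel_sup_gt0.
  move=> j z; rewrite ler_norml le_max lexx/= ge_max ge_min lexx/= andbT.
  lra.
move=> g Kg; have [mg gk] := kernel_class_bounded Kg.
have [j gj] := cov g Kg; exists j.
have mc : measurable_fun setT (c j).
  by have := cL j; rewrite inE => /andP[]; rewrite inE.
have := L2_dist_empirical mg mc (mulr_gt0 kernel_sup_gt0 eta0) gj.
apply: le_trans; apply: ler_sum => i _; exact: truncate_closer.
Qed.

End kernel_cover.

(** * Half-lines times kernels *)

Lemma countable_enum (U : Type) (A : set U) (u0 : U) : countable A -> A u0 ->
  exists e : nat -> U, (forall n, A (e n)) /\ forall u, A u -> exists n, e n = u.
Proof.
move=> /countable_injP[f injf] Au0.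
have : forall n, exists u, A u /\ ((exists v, A v /\ f v = n) -> f u = n).
  move=> n; have [[v [Av fv]]|nv] := pselect (exists v, A v /\ f v = n).
    by exists v.
  by exists u0; split.
move=> /choice[e eP]; exists e; split=> [n|u Au]; first exact: (eP n).1.
exists (f u); have [Ae fe] := eP (f u).
by apply: injf; rewrite ?inE//; apply: fe; exists u.
Qed.

Section half_lines.
Context {R : realType}.

(** Indicator of the half-line of [t], or of the whole line for [None], so that
    the numerator and the denominator of the estimator have one form. *)
Definition below (o : option R) (y : R) : R :=
  if o is Some t then (y <= t)%R%:R else 1.

(** The traces of half-lines on m points: empty, everything, or the points not
    above the j-th one. *)
Definition below_pattern m (y : nat -> R) (q : option (option 'I_m)) (i : nat) : R :=
  match q with
  | None => 0
  | Some None => 1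
  | Some (Some j) => (y i <= y j)%R%:R
  end.

Lemma below_patternP m (y : nat -> R) o :
  exists q : option (option 'I_m),
    forall i, (i < m)%N -> below o (y i) = below_pattern y q i.
Proof.
case: o => [t|]; last by exists (Some None).
have [/existsP[j0 yj0]|/existsPn none] := boolP [exists j : 'I_m, y j <= t].
  case: (@arg_maxP _ _ _ j0 (fun j => y j <= t) (fun j => y j)) => // j yj jmax.
  exists (Some (Some j)) => i im /=; congr (_%:R); congr nat_of_bool; apply/idP/idP => yi.
    exact: (jmax (Ordinal im)).
  exact: le_trans yj.
exists None => i im /=.
by have := none (Ordinal im); rewrite /= => /negbTE ->.
Qed.

Lemma below01 o y : 0 <= below o y <= 1.
Proof. by case: o => [t|]/=; [case: (y <= t)|]; rewrite ?lexx ?ler01. Qed.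

Lemma below_pattern01 m (y : nat -> R) (q : option (option 'I_m)) i :
  0 <= below_pattern y q i <= 1.
Proof.
case: q => [[j|]|]/=; rewrite ?lexx ?ler01//.
by case: (y i <= y j); rewrite ?lexx ?ler01.
Qed.

Lemma measurable_below o : measurable_fun setT (below o).
Proof.
case: o => [t|]; last exact: measurable_cst.
rewrite (_ : below _ = \1_`]-oo, t]); first exact: measurable_indic.
by apply/funext => y; rewrite indicE mem_setE in_itv.
Qed.

End half_lines.

Section halfline_kernels.
Context {R : realType} {d : nat} (K : 'rV[R]_d -> R).
Hypothesis K_regular : regular_kernel K.

Let kappa := fine (sup_abs K).

(** The kernel functions are divided by their supremum to be bounded by 1. The
    squares ([b = true]) belong to the class as well, because the deviation of
    the squares controls the empirical second moments. *)
Definition halfline_kernel (o : option R) (b : bool) (g : 'rV[R]_d -> R)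
    (u : measurableTypeR R * 'rV[R]_d) : R :=
  below o u.1 * (g u.2 / kappa) ^+ b.+1.

Let kappa0 : 0 < kappa. Proof. exact: kernel_sup_gt0. Qed.

Let normalized (v : R) : `|v| <= kappa -> `|v / kappa| <= 1.
Proof.
by move=> vk; rewrite normrM normfV (gtr0_norm kappa0) ler_pdivrMr// mul1r.
Qed.

Lemma halfline_kernel_le1 o b g u : kernel_class K g -> `|halfline_kernel o b g u| <= 1.
Proof.
move=> /(kernel_class_bounded K_regular)[_ gk].
rewrite normrM mulr_ile1//.
  by have /andP[b0 b1] := below01 o u.1; rewrite ger0_norm.
by rewrite normrX exprn_ile1// normalized.
Qed.

Lemma measurable_slab o b g : kernel_class K g ->
  measurable_fun setT (halfline_kernel o b g).
Proof.
move=> /(kernel_class_bounded K_regular)[mg _].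
apply: measurable_funM.
  exact: (measurableT_comp (@measurable_below _ o) measurable_fst).
apply: measurable_funX; apply: measurable_funM => //.
exact: (measurableT_comp mg measurable_snd).
Qed.

(** A cover of the kernel class times the finitely many traces of half-lines.
    Squaring at most doubles distances between functions bounded by 1, whence
    the factor 2 in the radius. *)
Lemma halfline_kernel_cover : exists C nu : R, [/\ 0 < C, 0 < nu &
  forall (eta : R) (z : nat -> measurableTypeR R * 'rV[R]_d) m, 0 < eta < 1 ->
  exists N (c : 'I_N -> nat -> R), [/\
    N%:R <= (m.+3 * 2)%:R * (C * eta `^ (- nu) + 1),
    forall j i, `|c j i| <= 1 &
    forall o b g, kernel_class K g -> exists j,
      \sum_(i < m.+1) `|halfline_kernel o b g (z i) - c j i| <= m.+1%:R * (2 * eta)]].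
Proof.
have [C [nu [C0 nu0 H]]] := kernel_cover K_regular; exists C, nu; split=> //.
move=> eta z m eta01; have [N [c [NC c1 cP]]] := H eta (snd \o z) m eta01.
(* Centers are indexed by a trace of half-lines, the exponent and a center for
   the kernel class. *)
pose J := (option (option 'I_m.+1) * bool * 'I_N)%type.
pose cJ (q : J) (i : nat) : R := below_pattern (fst \o z) q.1.1 i *
  (c q.2 (z i).2 / kappa) ^+ q.1.2.+1.
exists #|{: J}|, (fun j => cJ (enum_val j)); split.
- rewrite !card_prod !card_option card_bool !card_ord natrM.
  by rewrite ler_wpM2l// ler_nat.
- move=> j i; rewrite /cJ normrM mulr_ile1//.
    by have /andP[p0 p1] := below_pattern01 (fst \o z) (enum_val j).1.1 i; rewrite ger0_norm.
  by rewrite normrX exprn_ile1// normalized.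
move=> o b g Kg; have [_ gk] := kernel_class_bounded K_regular Kg.
have [q qP] := below_patternP m.+1 (fst \o z) o.
have [j jP] := cP g Kg.
exists (enum_rank ((q, b, j) : J)); rewrite enum_rankK.
apply: (@le_trans _ _ (\sum_(i < m.+1) 2 / kappa * `|g (z i).2 - c j (z i).2|)); last first.
  rewrite -mulr_sumr (le_trans (ler_wpM2l _ jP)) ?divr_ge0 ?(ltW kappa0)//.
  have aux (p s r : R) : p != 0 -> 2 / p * (s * (p * r)) = s * (2 * r).
    by move=> p0; field.
  by rewrite aux// gt_eqF.
apply: ler_sum => i _; rewrite /halfline_kernel /cJ/= [below o _](qP i (ltn_ord i)).
rewrite -mulrBr normrM.
have /andP[p0 p1] := below_pattern01 (fst \o z) q i.
rewrite (ger0_norm p0).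
have -> : 2 / kappa * `|g (z i).2 - c j (z i).2| =
    2 * `|g (z i).2 / kappa - c j (z i).2 / kappa|.
  by rewrite -mulrBl normrM normfV (gtr0_norm kappa0); field; rewrite gt_eqF.
move: (normalized (gk (z i).2)) (normalized (c1 j (z i).2)).
move: (g (z i).2 / kappa) (c j (z i).2 / kappa) => u v u1 v1.
apply: (@le_trans _ _ (`|u ^+ b.+1 - v ^+ b.+1|)); first by rewrite ler_piMl.
case: b => /=; last by rewrite !expr1 ler_peMl// ler1n.
rewrite subr_sqr normrM mulrC ler_wpM2r//.
by rewrite (le_trans (ler_normD _ _))// [leRHS](_ : _ = 1 + 1) ?lerD.
Qed.

End halfline_kernels.

Lemma covered_widen {R : realType} (T : Type) (f : nat -> T -> R) n a b N N' z :
  (N <= N')%N -> covered f n a b N z -> covered f n a b N' z.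
Proof.
move=> NN' [c [c1 fc]].
exists (fun j : 'I_N' => if insub (val j) is Some i then c i else fun=> 0); split.
  by move=> j i; case: insub => [k|]; rewrite ?normr0.
move=> k; have [j fj] := fc k; exists (widen_ord NN' j).
by rewrite /= valK.
Qed.

Section halfline_kernel_family.
Context {R : realType} {d : nat} (K : 'rV[R]_d -> R).
Hypothesis K_regular : regular_kernel K.
Variables (e : nat -> 'rV[R]_d -> R).
Hypothesis e_class : forall l, kernel_class K (e l).

(** The countable subclass: rational half-lines and an enumeration [e] of
    countably many kernel functions. *)
Definition halfline_kernel_family (k : nat) : measurableTypeR R * 'rV[R]_d -> R :=
  let: (o, b, l) := odflt (None, false, 0%N)
    (unpickle k : option (option rat * bool * nat)) in
  halfline_kernel K (omap ratr o) b (e l).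

Lemma halfline_kernel_familyP o b l :
  halfline_kernel_family (pickle (o, b, l)) = halfline_kernel K (omap ratr o) b (e l).
Proof. by rewrite /halfline_kernel_family pickleK. Qed.

Lemma halfline_kernel_family_le1 k u : `|halfline_kernel_family k u| <= 1.
Proof.
rewrite /halfline_kernel_family; case: (odflt _ _) => [[t c] l]; exact: halfline_kernel_le1.
Qed.

Lemma measurable_slab_family k : measurable_fun setT (halfline_kernel_family k).
Proof.
rewrite /halfline_kernel_family; case: (odflt _ _) => [[t c] l]; exact: measurable_slab.
Qed.

Lemma halfline_kernel_family_covered : exists C nu : R, [/\ 0 < C, 0 < nu &
  forall n (a b : R), (0 < n)%N -> 0 < a < 1 -> 0 < b < 1 ->
  exists N, N%:R <= (n.*2.+2 * 2)%:R * (C * (b * a / 16) `^ (- nu) + 1) /\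
    forall z, covered halfline_kernel_family n a b N z].
Proof.
have [C [nu [C0 nu0 H]]] := halfline_kernel_cover K_regular; exists C, nu; split=> //.
move=> n a b n0 /andP[a0 a1] /andP[b0 b1].
have eta01 : 0 < b * a / 16 < 1.
  apply/andP; split; first by rewrite divr_gt0// mulr_gt0.
  have : b * a < 1 by rewrite mulr_ilt1// ltW.
  lra.
set bnd := _ * (_ + 1); have bnd0 : 0 <= bnd.
  by rewrite mulr_ge0// addr_ge0// mulr_ge0 ?powR_ge0// ltW.
exists (Num.truncn bnd); split.
  by have /andP[] := truncn_itv bnd0.
move=> z; have [N [c [NB c1 cP]]] := H _ z n.*2.-1 eta01.
have n2 : n.*2.-1.+1 = n.*2 by rewrite prednK// double_gt0.
rewrite n2 in NB cP.
apply: (@covered_widen _ _ _ _ _ _ N).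
  by rewrite truncn_ge_nat.
exists c; split=> // k; rewrite /halfline_kernel_family.
case: (odflt _ _) => [[t q] l].
have [j jP] := cP (omap ratr t) q (e l) (e_class l).
exists j; rewrite (le_trans jP)// -muln2 natrM le_eqVlt.
by apply/orP; left; apply/eqP; field.
Qed.

End halfline_kernel_family.

(** * Summable probabilities *)

Section borel_cantelli.
Context {R : realType} d (Omega : measurableType d) (P : probability Omega R).

Lemma telescope_bound (N m : nat) :
  \sum_(N <= i < m) ((i.+1%:R * i.+2%:R)^-1 : R) <= 1.
Proof.
have [mN|Nm] := leqP m N; first by rewrite big_geq.
rewrite (eq_big_nat _ _ (F2 := fun i => - (i.+2%:R)^-1 - (- (i.+1%:R)^-1))); last first.
  move=> i _; have aux (x : R) : 0 < x -> (x * (x + 1))^-1 = - (x + 1)^-1 - - x^-1.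
    by move=> x0; field; rewrite !gt_eqF// addr_gt0.
  by rewrite -[i.+2%:R]natr1 aux// ltr0n.
rewrite (telescope_sumr (fun i => - (i.+1%:R)^-1 : R)) ?(ltnW Nm)//.
rewrite opprK addrC (le_trans (y := N.+1%:R^-1))//.
  by rewrite gerBl invr_ge0.
by rewrite invf_le1// ler1n.
Qed.

(** Borel-Cantelli with an explicit summable bound. *)
Lemma eventually_not (A : nat -> set Omega) : (forall n, measurable (A n)) ->
  (\forall n \near \oo, (P (A n) <= (n.+1%:R * n.+2%:R)^-1%:E)%E) ->
  {ae P, forall w, \forall n \near \oo, ~ A n w}.
Proof.
move=> mA [N _ NP]; pose B n := if (n < N)%N then set0 else A n.
have mB n : measurable (B n) by rewrite /B; case: ifP.
have B0 : P (lim_sup_set B) = 0%E.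
  apply: lim_sup_set_cvg0 => //.
  rewrite (@le_lt_trans _ _ 1%E) ?ltry//.
  apply: lime_le; first exact: is_cvg_nneseries.
  apply: nearW => m /=.
  apply: (@le_trans _ _ (\sum_(0 <= i < m) (i.+1%:R * i.+2%:R)^-1)%:E); last first.
    by rewrite lee_fin telescope_bound.
  rewrite -sumEFin; apply: lee_sum => i _; rewrite /B; case: ltnP => iN.
    by rewrite measure0 lee_fin invr_ge0 mulr_ge0.
  exact: NP.
exists (lim_sup_set B); split=> //.
  by apply: bigcap_measurableType => k _; exact: bigcup_measurable.
move=> w /= nA k _.
apply: contrapT => nB; apply: nA.
(* A later occurrence of [A] is one of [B], as they agree from [N] on. *)
exists (maxn k N) => // n /=; rewrite geq_max => /andP[kn Nn] An.
by apply: nB; exists n => //; rewrite /B ltnNge Nn.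
Qed.

End borel_cantelli.

Section polynomial_vs_exponential.
Context {R : realType}.

(** As n a_n >= 1 eventually, N is at most of order n ^ (1 + nu), while
    exp(- c n a_n) is below n ^ (- (5 + nu)) because n a_n >> ln n. One of the
    remaining powers of n absorbs the constants. *)
Lemma polynomial_cover_bound (a : nat -> R) (C nu b c : R) :
  0 < C -> 0 < nu -> 0 < b -> 0 < c -> (forall n, 0 < a n) ->
  (n%:R * a n / ln (n%:R : R)) @[n --> \oo] --> +oo ->
  \forall n \near \oo, forall N : nat,
    N%:R <= (n.*2.+2 * 2)%:R * (C * (b * a n) `^ (- nu) + 1) ->
    4 * N%:R * expR (- (c * (n%:R * a n))) <= (n.+1%:R * n.+2%:R)^-1.
Proof.
move=> C0 nu0 b0 c0 a0 na.
(* Once n a_n >= M ln n, the exponential is at most n ^ (- (5 + nu)). *)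
pose M : R := (5 + nu) / c; have M0 : 0 < M by rewrite divr_gt0// addr_gt0.
pose D : R := C * expR (- nu * ln b); have D0 : 0 < D by rewrite mulr_gt0// expR_gt0.
have aux (m : nat) : (3 <= m)%N -> (m.*2.+2 * 2 <= 8 * m)%N.
  by rewrite -muln2; clear; lia.
have aux3 (m : nat) : (3 <= m)%N -> (m.+1 * m.+2 <= m ^ 3)%N.
  clear; move=> m3.
  have h1 : (3 * (m * m) <= m ^ 3)%N by rewrite 2!expnS expn1 leq_mul2r m3 orbT.
  have h2 : (3 * m <= m * m)%N by rewrite leq_mul2r m3 orbT.
  by rewrite (leq_trans _ h1)// mulSn mulnS; lia.
near=> n => N NB.
have n3 : (3 <= n)%N by near: n; exact: nbhs_infty_ge.
have n0 : (0 < n%:R :> R) by rewrite ltr0n (leq_trans _ n3).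
have L1 : 1 <= ln (n%:R : R).
  rewrite -[leLHS]expRK ler_ln ?posrE ?expR_gt0//.
  near: n; exact: nbhs_infty_ger.
have L0 : 0 < ln (n%:R : R) by exact: lt_le_trans L1.
have naM : M * ln (n%:R : R) <= n%:R * a n.
  rewrite -ler_pdivlMr//; near: n.
  by apply: (cvgryPge _).1.
have naL : ln (n%:R : R) <= n%:R * a n.
  rewrite -[leLHS]mul1r -ler_pdivlMr//; near: n.
  by apply: (cvgryPge _).1.
have na1 : 1 <= n%:R * a n by exact: le_trans naL.
have nD : 32 * (D + 1) <= n%:R by near: n; exact: nbhs_infty_ger.
set L := ln n%:R in L1 L0 naM naL.
have nE : n%:R = expR L by rewrite lnK.
have pw : C * (b * a n) `^ (- nu) <= D * expR (nu * L).
  rewrite /powR gt_eqF ?mulr_gt0// /D -mulrA ler_pM2l// -expRD ler_expR.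
  rewrite lnM ?posrE// mulrDr lerD2l mulNr -mulrN ler_pM2l//.
  rewrite -lnV ?posrE// ler_ln ?posrE ?invr_gt0// -div1r ler_pdivrMr//.
have eL1 : 1 <= expR (nu * L) by rewrite -expR0 ler_expR mulr_ge0 ?ltW.
have NB' : N%:R <= 8 * (D + 1) * (expR L * expR (nu * L)).
  apply: (le_trans NB).
  apply: (@le_trans _ _ (8 * n%:R * ((D + 1) * expR (nu * L)))); last first.
    by rewrite nE le_eqVlt; apply/orP; left; apply/eqP; ring.
  apply: ler_pM => //.
  - by rewrite addr_ge0// mulr_ge0 ?powR_ge0// ltW.
  - by rewrite -natrM ler_nat aux.
  - by rewrite mulrDl mul1r lerD.
have -> : - (c * (n%:R * a n)) = - (5 + nu) * L + ((5 + nu) * L - c * (n%:R * a n)) by ring.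
apply: (@le_trans _ _ (4 * N%:R * expR (- (5 + nu) * L))).
  rewrite ler_wpM2l ?mulr_ge0// ler_expR gerDl subr_le0.
  by rewrite (_ : (5 + nu) * L = c * (M * L)) ?ler_pM2l// /M; field; rewrite gt_eqF.
apply: (@le_trans _ _ (expR (- (3 * L)))).
  apply: (@le_trans _ _ (4 * (8 * (D + 1) * (expR L * expR (nu * L))) * expR (- (5 + nu) * L))).
    by rewrite ler_wpM2r ?expR_ge0// ler_wpM2l.
  have -> : 4 * (8 * (D + 1) * (expR L * expR (nu * L))) * expR (- (5 + nu) * L) =
    32 * (D + 1) * (expR L * expR (nu * L) * expR (- (5 + nu) * L)) by ring.
  rewrite -!expRD; apply: (@le_trans _ _ (expR L * expR (L + nu * L + - (5 + nu) * L))).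
    by rewrite ler_wpM2r ?expR_ge0// -nE.
  rewrite -expRD ler_expR. lra.
rewrite expRN lef_pV2 ?posrE ?mulr_gt0 ?expR_gt0//.
have -> : expR (3 * L) = n%:R ^+ 3.
  by rewrite nE !exprS expr0 mulr1 -!expRD; congr expR; ring.
by rewrite -natrX -natrM ler_nat aux3.
Unshelve. all: by end_near. Qed.

End polynomial_vs_exponential.

(** * Almost sure deviations over the whole class *)

(** Sums, means and second moments are all continuous along bounded pointwise
    limits, hence so is the inequality. *)
Lemma deviation_limit {R : realType} d (T : measurableType d)
    (Q : probability T R) (u : nat -> T -> R) (v : T -> R) n (x : nat -> T)
    (dl c : R) :
  (forall m, measurable_fun setT (u m)) -> (forall m z, `|u m z| <= 1) ->
  measurable_fun setT v ->
  (forall z, u m z @[m --> \oo] --> v z) ->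
  (forall m, `|\sum_(i < n) u m (x i) - n%:R * \int[Q]_z u m z| <=
     dl * (n%:R * \int[Q]_z (u m z ^+ 2) + \sum_(i < n) u m (x i) ^+ 2 + c)) ->
  `|\sum_(i < n) v (x i) - n%:R * \int[Q]_z v z| <=
     dl * (n%:R * \int[Q]_z (v z ^+ 2) + \sum_(i < n) v (x i) ^+ 2 + c).
Proof.
move=> mu u1 mv uv H.
have cvgint (u' : nat -> T -> R) (v' : T -> R) :
    (forall m, measurable_fun setT (u' m)) -> (forall m z, `|u' m z| <= 1) ->
    measurable_fun setT v' -> (forall z, u' m z @[m --> \oo] --> v' z) ->
    \int[Q]_z u' m z @[m --> \oo] --> \int[Q]_z v' z.
  move=> mu' u1' mv' uv'.
  have [|||||iv _ H'] := @dominated_convergence _ _ _ Q setT measurableT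
    (fun m z => (u' m z)%:E) (EFin \o v') (cst 1%E).
  - by move=> m; exact/measurable_EFinP.
  - exact/measurable_EFinP.
  - by apply: aeW => z _; apply: cvg_EFin; [exact: nearW|exact: uv'].
  - by apply: (@bounded_integrable _ _ _ Q (cst 1) 1) => // z; rewrite normr1.
  - by apply: aeW => z m _; rewrite lee_fin.
  apply: fine_cvg; rewrite fineK//.
  exact: integrable_fin_num.
have cvgS (u' : nat -> T -> R) (v' : T -> R) :
    (forall z, u' m z @[m --> \oo] --> v' z) ->
    \sum_(i < n) u' m (x i) @[m --> \oo] --> \sum_(i < n) v' (x i).
  by move=> uv'; apply: cvg_big => [|i _]; [exact: add_continuous|exact: uv'].
have uv2 z : u m z ^+ 2 @[m --> \oo] --> v z ^+ 2.
  by rewrite expr2; under eq_fun do rewrite expr2; exact: cvgM.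
have cl : `|\sum_(i < n) u m (x i) - n%:R * \int[Q]_z u m z| @[m --> \oo] -->
    `|\sum_(i < n) v (x i) - n%:R * \int[Q]_z v z|.
  apply: cvg_norm; apply: cvgB; first exact: cvgS.
  by apply: cvgM; [exact: cvg_cst|exact: cvgint].
have cr : dl * (n%:R * \int[Q]_z (u m z ^+ 2) + \sum_(i < n) u m (x i) ^+ 2 + c)
    @[m --> \oo] -->
    dl * (n%:R * \int[Q]_z (v z ^+ 2) + \sum_(i < n) v (x i) ^+ 2 + c).
  apply: cvgM; first exact: cvg_cst.
  apply: cvgD; last exact: cvg_cst.
  apply: cvgD; last exact: (cvgS (fun m z => u m z ^+ 2) (fun z => v z ^+ 2)).
  apply: cvgM; first exact: cvg_cst.
  apply: (cvgint (fun m z => u m z ^+ 2)) => //.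
  - by move=> m; exact: measurable_funX.
  - by move=> m z; rewrite normrX exprn_ile1.
  - exact: measurable_funX.
by apply: ler_cvg_to cl cr _; exact: nearW.
Qed.

Lemma below_right_continuous {R : realType} (o : option R) :
  exists r : nat -> option rat,
  forall y, below (omap ratr (r m)) y @[m --> \oo] --> below o y.
Proof.
case: o => [t|]; last by exists (fun=> None) => y; exact: cvg_cst.
have : forall m : nat, exists q : rat, t < ratr q < t + m.+1%:R^-1.
  move=> m; have /rat_in_itvoo[q] : t < t + m.+1%:R^-1 by rewrite ltrDl.
  by rewrite in_itv/= => qt; exists q.
move=> /choice[q qP]; exists (Some \o q) => y /=.
have [yt|ty] := leP y t.
  apply: cvg_near_cst; apply: nearW => m.
  by have /andP[/ltW tq _] := qP m; rewrite (le_trans yt tq).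
apply: cvg_near_cst; near=> m.
have /andP[_ qt] := qP m.
suff -> : (y <= ratr (q m)) = false by [].
apply/negbTE; rewrite -ltNge (lt_trans qt)// -ltrBrDl.
near: m.
have yt0 : 0 < y - t by rewrite subr_gt0.
exact: (near_infty_natSinv_lt (PosNum yt0)).
Unshelve. all: by end_near. Qed.

Section halfline_kernel_deviation.
Context {R : realType} {d : nat} disp (Omega : measurableType disp).
Variables (P : probability Omega R).
Variable W : nat -> {RV P >-> (measurableTypeR R * 'rV[R]_d)%type}.
Hypothesis W_iid : iid P W.
Variable K : 'rV[R]_d -> R.
Hypothesis K_regular : regular_kernel K.
Variable a : nat -> R.
Hypothesis a01 : forall n, 0 < a n < 1.
Hypothesis na_cvgy : (n%:R * a n / ln (n%:R : R)) @[n --> \oo] --> +oo.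

Let Q := distribution P (W 0%N).

(** Borel-Cantelli for the events of [relative_deviation_probability]. The
    sample consists of the terms 1, ..., n of the sequence. *)
Lemma halfline_kernel_family_deviation (e : nat -> 'rV[R]_d -> R) (dl : R) :
  (forall l, kernel_class K (e l)) -> 0 < dl <= 1 ->
  {ae P, forall w, \forall n \near \oo, forall k,
    ~ relative_deviation W (halfline_kernel_family K e) n (a n) dl k (fun i => W i.+1 w)}.
Proof.
move=> e_class dl01; have /andP[dl0 dl1] := dl01.
have mf := measurable_slab_family K_regular e_class.
have f1 := halfline_kernel_family_le1 K_regular e_class.
have [C [nu [C0 nu0 cov]]] := halfline_kernel_family_covered K_regular e_class.
pose A n := subsample W succn @^-1`
  \bigcup_k relative_deviation W (halfline_kernel_family K e) n (a n) dl k.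
have mA n : measurable (A n).
  apply: subsample_preimage_measurable; apply: bigcupT_measurable => k.
  exact: relative_deviation_measurable.
have : {ae P, forall w, \forall n \near \oo, ~ A n w}.
  apply: eventually_not => //.
  have b0 : 0 < dl / 8 / 16 by rewrite !divr_gt0.
  have c0 : 0 < (dl / 8) ^+ 2 / 16 by rewrite divr_gt0// exprn_gt0// divr_gt0.
  have a0 n : 0 < a n by have /andP[] := a01 n.
  have := polynomial_cover_bound C0 nu0 b0 c0 a0 na_cvgy.
  move=> bound; near=> n.
  have n0 : (0 < n)%N by near: n; exact: nbhs_infty_gt.
  have n3 : 1 <= ln (n%:R : R).
    rewrite -[leLHS]expRK ler_ln ?posrE ?expR_gt0 ?ltr0n//.
    near: n; exact: nbhs_infty_ger.
  have b01 : 0 < dl / 8 < 1 by apply/andP; split; lra.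
  have [N [NB Ncov]] := cov n (a n) (dl / 8) n0 (a01 n) b01.
  have large : 16 <= dl ^+ 2 * (n%:R * a n).
    rewrite mulrC -ler_pdivrMr ?exprn_gt0//.
    have : 16 / dl ^+ 2 * ln (n%:R : R) <= n%:R * a n.
      rewrite -ler_pdivlMr ?(lt_le_trans ltr01 n3)//; near: n.
      by apply: (cvgryPge _).1.
    apply: le_trans; rewrite ler_peMr// divr_ge0// exprn_ge0//; exact: ltW.
  have := relative_deviation_probability W_iid mf f1 (a0 n) dl01 large succn_inj Ncov.
  move=> /le_trans; apply; rewrite lee_fin.
  have bn : forall N : nat,
      N%:R <= (n.*2.+2 * 2)%:R * (C * (dl / 8 / 16 * a n) `^ (- nu) + 1) ->
      4 * N%:R * expR (- ((dl / 8) ^+ 2 / 16 * (n%:R * a n))) <=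
      (n.+1%:R * n.+2%:R)^-1.
    by near: n; exact: bound.
  rewrite (_ : (dl / 8) ^+ 2 * (n%:R * a n) / 16 =
    (dl / 8) ^+ 2 / 16 * (n%:R * a n)); last by ring.
  by apply: bn; rewrite mulrAC.
apply: filterS => w; apply: filterS => n nA k dev; apply: nA.
by exists k.
Unshelve. all: by end_near. Qed.

(** The passage from the countable subclass to all half-lines and all kernel
    functions; no bandwidth occurs in the inequality. *)
Lemma halfline_kernel_deviation (dl : R) : 0 < dl <= 1 ->
  {ae P, forall w, \forall n \near \oo, forall o b g, kernel_class K g ->
    `|\sum_(i < n) halfline_kernel K o b g (W i.+1 w) -
      n%:R * \int[Q]_z halfline_kernel K o b g z| <=
    dl * (n%:R * \int[Q]_z (halfline_kernel K o b g z ^+ 2) +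
      \sum_(i < n) halfline_kernel K o b g (W i.+1 w) ^+ 2 + n%:R * a n)}.
Proof.
move=> dl01.
have [G0 [cG0 G0K G0P]] := kernel_class_measurable K_regular.
have [g0 [g0G0 _]] : exists g, G0 g /\ True.
  have [u [uG0 _]] := G0P (rescale K 1 0) (ex_intro _ 1 (ex_intro _ 0 (conj ltr01 erefl))).
  by exists (u 0%N).
have [e [eG0 eP]] := countable_enum cG0 g0G0.
have eK l : kernel_class K (e l) by exact: G0K.
have := halfline_kernel_family_deviation eK dl01; apply: filterS => w.
apply: filterS => n dev o b g Kg.
have [u [uG0 ug]] := G0P g Kg.
have [r rP] := below_right_continuous o.
apply: (@deviation_limit _ _ _ Q (fun m => halfline_kernel K (omap ratr (r m)) b (u m))
  (halfline_kernel K o b g) n (fun i => W i.+1 w)).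
- by move=> m; apply: measurable_slab => //; exact: G0K.
- by move=> m z; apply: halfline_kernel_le1 => //; exact: G0K.
- exact: measurable_slab.
- move=> z; apply: cvgM; first exact: rP.
  have cvgk : u m z.2 / fine (sup_abs K) @[m --> \oo] --> g z.2 / fine (sup_abs K).
    by apply: cvgM; [exact: ug|exact: cvg_cst].
  case: b => /=; last by rewrite expr1; under eq_fun do rewrite expr1.
  by rewrite expr2; under eq_fun do rewrite expr2; exact: cvgM.
move=> m; have [l <-] := eP _ (uG0 m).
have := dev (pickle (r m, b, l)); rewrite /relative_deviation/= halfline_kernel_familyP.
by move/negP; rewrite -leNgt.
Qed.

End halfline_kernel_deviation.

(** * Lebesgue measure under reflections and dilations *)

Section lebesgue_affine.
Context {R : realType}.
Local Notation lambda := (@lebesgue_measure R).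

Definition reflect_scale (s z x : R) : R := s^-1 * (z - x).

Lemma measurable_reflect_scale s z : measurable_fun setT (reflect_scale s z).
Proof. by apply: measurable_funM => //; apply: measurable_funB. Qed.

(** It suffices to compare the two measures on half-open intervals. *)
Lemma lebesgue_reflect_scale (s z : R) (A : set R) : 0 < s -> measurable A ->
  lambda (reflect_scale s z @^-1` A) = (s%:E * lambda A)%E.
Proof.
move=> s0 mA.
have sV0 : 0 <= s^-1 by rewrite invr_ge0 ltW.
have mphi : @measurable_fun _ _ (measurableTypeR R) (measurableTypeR R)
  setT (reflect_scale s z) by exact: measurable_reflect_scale.
pose phi : {mfun measurableTypeR R >-> measurableTypeR R} :=
  HB.pack (reflect_scale s z : measurableTypeR R -> measurableTypeR R)
  (isMeasurableFun.Build _ _ _ _ _ mphi).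
pose pf : {measure set (measurableTypeR R) -> \bar R} :=
  measure_function_pushforward__canonical__measure_function_Measure lambda mphi.
pose mu := mscale (NngNum sV0) pf.
suff H : lambda A = mu A.
  rewrite H /mu/= /mscale/= /pushforward muleA -EFinM divff ?gt_eqF//.
  by rewrite mul1e.
apply: (@lebesgue_measure_unique _ mu) mA.
move=> _ [[a b] _ <-]; rewrite /mu/= /mscale/= /pushforward.
have -> : phi @^-1` `]a, b]%classic = `[z - s * b, z - s * a[%classic.
  apply/seteqP; split=> x /=; rewrite !in_itv/= /reflect_scale;
    rewrite ltr_pdivlMl// ler_pdivrMl// => /andP[h1 h2]; apply/andP; split; lra.
rewrite !lebesgue_measure_itv/= !lte_fin.
rewrite (_ : (z - s * b < z - s * a) = (a < b)); last first.
  by rewrite ltrD2l ltrN2 ltr_pM2l.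
case: ifP => _; last by rewrite mule0.
rewrite -!EFinB -EFinM; congr EFin; field.
by rewrite gt_eqF.
Qed.

Definition boxes n : set (set 'rV[R]_n) :=
  [set B | exists A : 'I_n -> set R, (forall i, measurable (A i)) /\
    B = [set v : 'rV[R]_n | forall i, A i (v ord0 i)]].

(** The coordinates are measurable for the sigma-algebra of the boxes, hence so
    is the identity into the Borel sets. *)
Lemma measurable_boxesE n : @measurable _ 'rV[R]_n = <<s @boxes n >>.
Proof.
apply/seteqP; split=> [A mA|]; last first.
  apply: smallest_sub; first exact: sigma_algebra_measurable.
  move=> _ [A [mA ->]].
  rewrite [X in measurable X](_ : _ = \bigcap_(i in [set: 'I_n])
      ((fun v : 'rV[R]_n => v ord0 i) @^-1` A i)).
    apply: fin_bigcap_measurable => // i _; rewrite -[X in measurable X]setTI.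
    exact: measurable_coord.
  by apply/seteqP; split=> v /= vA i; [move=> _; exact: vA|exact: vA i I].
have mid : measurable_fun setT (id : g_sigma_algebraType (@boxes n) -> 'rV[R]_n).
  apply/measurable_fun_rVP => i _ B mB; rewrite setTI.
  apply: sub_sigma_algebra; exists (fun j => if j == i then B else setT).
  split; first by move=> j; case: ifP.
  apply/seteqP; split=> v /= vB; last by have := vB i; rewrite eqxx.
  by move=> j; case: eqP => [->|].
have := mid measurableT _ mA.
by rewrite setTI preimage_id.
Qed.

Lemma rV_norm_leP n (v : 'rV[R]_n) (r : R) : 0 <= r ->
  (`|v| <= r) <-> forall i, `|v ord0 i| <= r.
Proof.
move=> r0; rewrite [`|v|](mx_normrE v); split=> [/bigmax_leP[_ H] i|H].
  exact: (H (ord0, i)).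
by apply/bigmax_leP; split=> // -[i j] _; rewrite /= ord1.
Qed.

Definition cube n (k : nat) : set 'rV[R]_n :=
  [set v : 'rV[R]_n | forall i, `[- k%:R, k%:R]%classic (v ord0 i)].

Lemma boxes_unique n (m1 m2 : {measure set 'rV[R]_n -> \bar R}) :
  (forall k : nat, m1 (@cube n k) < +oo)%E ->
  (forall B, boxes B -> m1 B = m2 B) ->
  forall A, measurable A -> m1 A = m2 A.
Proof.
move=> m1oo m12 A mA.
apply: (@measure_unique _ R _ (@boxes n) (@cube n)
  (measurable_boxesE n) _ _ _ m1 m2 m12 m1oo A mA).
- move=> _ _ [B [mB ->]] [B' [mB' ->]].
  exists (fun i => B i `&` B' i); split; first by move=> i; exact: measurableI.
  by apply/seteqP; split=> v /=; [move=> [? ?] i|move=> H; split=> i; have [] := H i].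
- by move=> k; exists (fun=> `[- k%:R, k%:R]%classic).
apply/seteqP; split=> // v _; exists (Num.truncn `|v|).+1 => // i /=.
rewrite in_itv/= -ler_norml (le_trans (y := `|v|))//.
  exact: (rV_norm_leP v (normr_ge0 v)).1.
by rewrite ltW// truncnS_gt.
Qed.

Lemma lebesgue_rV_reflect_scale n (s : R) (z : 'rV[R]_n) (A : set 'rV[R]_n) :
  0 < s -> measurable A ->
  lebesgue_rV n ((fun x => s^-1 *: (z - x)) @^-1` A) =
  ((s ^+ n)%:E * lebesgue_rV n A)%E.
Proof.
move=> s0 mA.
have sV0 : 0 <= (s ^+ n)^-1 by rewrite invr_ge0 exprn_ge0// ltW.
have mphi : measurable_fun setT (fun x : 'rV[R]_n => s^-1 *: (z - x)).
  exact: measurable_reflect.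
pose phi : {mfun 'rV[R]_n >-> 'rV[R]_n} :=
  HB.pack (fun x : 'rV[R]_n => s^-1 *: (z - x)) (isMeasurableFun.Build _ _ _ _ _ mphi).
pose pf : {measure set 'rV[R]_n -> \bar R} :=
  measure_function_pushforward__canonical__measure_function_Measure (lebesgue_rV n) mphi.
pose mu := mscale (NngNum sV0) pf.
suff H : lebesgue_rV n A = mu A.
  rewrite H /mu/= /mscale/= /pushforward muleA -EFinM divff ?mul1e//.
  by rewrite gt_eqF// exprn_gt0.
apply: (boxes_unique (m1 := lebesgue_rV n) (m2 := mu) _ _ mA).
  move=> k; rewrite [X in (X < _)%E](@lebesgue_rV_box _ _ (fun=> `[- k%:R, k%:R]%classic))//.
  rewrite [X in (X < _)%E](_ : _ = (\prod_(i < n) (k%:R - - k%:R))%:E) ?ltry//.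
  rewrite -prodEFin; apply: eq_bigr => i _.
  rewrite lebesgue_measure_itv/= lte_fin.
  case: ltP => // kk; congr EFin.
  by have := ler0n R k; lra.
move=> _ [B [mB ->]]; rewrite /mu/= /mscale/= /pushforward.
have -> : phi @^-1` [set v : 'rV[R]_n | forall i, B i (v ord0 i)] =
    [set v : 'rV[R]_n | forall i, (reflect_scale s (z ord0 i) @^-1` B i) (v ord0 i)].
  by apply/seteqP; split=> v /= vB i; have := vB i; rewrite !mxE.
rewrite lebesgue_rV_box//.
rewrite [X in (_ * X)%E](@lebesgue_rV_box _ _
  (fun i => reflect_scale s (z ord0 i) @^-1` B i)); last first.
  move=> i; rewrite -[X in measurable X]setTI.
  exact: measurable_reflect_scale.
under [in RHS]eq_bigr do rewrite lebesgue_reflect_scale//.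
rewrite big_split/= prodEFin prodr_const card_ord muleA -EFinM mulVf ?mul1e//.
by rewrite gt_eqF// exprn_gt0.
Qed.

End lebesgue_affine.

(** * Expectations as integrals against a density *)

Section density.
Context {R : realType} d (T : measurableType d).
Variables (Q : probability T R) (mu : {sigma_finite_measure set T -> \bar R}).
Variable p : T -> R.
Hypothesis Qp : has_density Q mu p.

Lemma density_integrable : mu.-integrable setT (EFin \o p).
Proof.
have [mp p0 pE] := Qp; apply/integrableP; split; first exact/measurable_EFinP.
under eq_integral do rewrite /= ger0_norm//.
have -> : (\int[mu]_x (p x)%:E = 1)%E; last exact: ltry.
by rewrite -pE//; exact: probability_setT.
Qed.

(** The density coincides almost everywhere with the Radon-Nikodym derivative,
    for which the formula is known. *)
Lemma density_change_of_variables (f : T -> R) (c : R) :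
  measurable_fun setT f -> (forall x, `|f x| <= c) ->
  mu.-integrable setT (fun x => (f x * p x)%:E) /\
  (\int[Q]_x (f x)%:E = \int[mu]_x (f x * p x)%:E)%E.
Proof.
move=> mf fc; have [mp p0 pE] := Qp.
have ip := density_integrable.
split.
  apply: (@le_integrable _ _ _ _ _ measurableT _ (fun x => `|c|%:E * (p x)%:E)%E).
  - by apply/measurable_EFinP; exact: measurable_funM.
  - move=> x _; rewrite -EFinM !abse_EFin lee_fin !normrM normr_id ler_wpM2r//.
    by rewrite (le_trans (fc x))// ler_norm.
  - exact: integrableZl.
have dom : Q `<< mu.
  apply/null_content_dominatesP => A mA muA.
  rewrite pE// null_set_integral//.
  by apply: measurable_funTS; exact/measurable_EFinP.
rewrite -(Radon_Nikodym_change_of_variables dom measurableT (f := EFin \o f)); last first.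
  exact: (bounded_integrable _ mf fc).
apply: ae_eq_integral => //.
- apply: emeasurable_funM; first exact/measurable_EFinP.
  by apply: measurable_int; exact: Radon_Nikodym_integrable.
- by apply/measurable_EFinP; exact: measurable_funM.
under [X in ae_eq _ _ _ X]eq_fun do rewrite EFinM.
apply: ae_eqe_mul2l; apply: integral_ae_eq => //.
- exact: Radon_Nikodym_integrable.
- exact/measurable_EFinP.
move=> E _ mE; rewrite -pE//; symmetry.
exact: (@Radon_Nikodym_integral _ _ _ (charge_of_finite_measure Q) mu E dom mE).
Qed.

End density.

Lemma product_sigma_finite {R : realType} d1 d2 (T1 : measurableType d1)
    (T2 : measurableType d2) (m1 : {sigma_finite_measure set T1 -> \bar R})
    (m2 : {sigma_finite_measure set T2 -> \bar R}) :
  sigma_finite setT (m1 \x m2)%E.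
Proof.
have /sigma_finiteP[F [TF ndF Foo]] := sigma_finiteT m1.
have /sigma_finiteP[G [TG ndG Goo]] := sigma_finiteT m2.
exists (fun n => F n `*` G n) => [|k].
  rewrite -setXTT TF TG; apply/seteqP; split=> [[x y] [[n _ Fx] [k _ Gy]]|].
    exists (maxn n k) => //; split.
      by have /subsetPset := ndF _ _ (leq_maxl n k); apply.
    by have /subsetPset := ndG _ _ (leq_maxr n k); apply.
  by move=> [x y] [n _ [Fx Gy]]; split; exists n.
have [mF Fk] := Foo k; have [mG Gk] := Goo k; split; first exact: measurableX.
by rewrite product_measure1E// lte_mul_pinfty// ge0_fin_numE.
Qed.

(** The order of integration puts the second variable outside: an expectation is
    an integral over x of integrals of sections p(., x). *)
Lemma product_density_fubini {R : realType} d1 d2 (T1 : measurableType d1)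
    (T2 : measurableType d2) (m1 : {sigma_finite_measure set T1 -> \bar R})
    (m2 : {sigma_finite_measure set T2 -> \bar R}) (Q : probability (T1 * T2)%type R)
    (p : T1 * T2 -> R) (f : T1 * T2 -> R) (c : R) :
  has_density Q (m1 \x m2)%E p ->
  measurable_fun setT f -> (forall x, `|f x| <= c) ->
  m2.-integrable setT (fun x => \int[m1]_y (f (y, x) * p (y, x))%:E)%E /\
  (\int[Q]_z (f z)%:E =
   \int[m2]_x \int[m1]_y (f (y, x) * p (y, x))%:E)%E.
Proof.
move=> Qp mf fc.
pose mu : {sigma_finite_measure set (T1 * T2)%type -> \bar R} :=
  HB.pack (m1 \x m2)%E (Measure_isSigmaFinite.Build _ _ _ (m1 \x m2)%E
    (product_sigma_finite m1 m2)).
have [ip Ep] := @density_change_of_variables R _ _ Q mu p Qp f c mf fc.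
have mfp := measurable_int _ ip.
split; last by rewrite Ep -(integral21_prod_meas1 ip).
apply/integrableP; split; first exact: (measurable_fubini_G ip).
apply: le_lt_trans ((integrable21ltyP m1 m2 mfp).1 ip).
apply: ge0_le_integral => //.
- by apply: measurableT_comp => //; exact: (measurable_fubini_G ip).
- apply: (@measurable_fun_fubini_tonelli_G _ _ _ _ _ m1
    (fun z => `|(f z * p z)%:E|%E)) => //; exact: measurableT_comp.
move=> x _; apply: le_abse_integral => //.
exact: (measurableT_comp mfp (pair2_measurable x)).
Qed.

(** * Sections of the density *)

(** |g_n - f| = (g_n - f) + 2 max(0, f - g_n), where the last term is dominated
    by f and tends to 0. *)
Lemma scheffe {R : realType} d (T : measurableType d)
    (mu : {measure set T -> \bar R}) (g : nat -> T -> R) (f : T -> R) :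
  (forall n x, 0 <= g n x) -> (forall x, 0 <= f x) ->
  (forall n, mu.-integrable setT (EFin \o g n)) ->
  mu.-integrable setT (EFin \o f) ->
  {ae mu, forall x, g n x @[n --> \oo] --> f x} ->
  \int[mu]_x g n x @[n --> \oo] --> \int[mu]_x f x ->
  \int[mu]_x `|g n x - f x| @[n --> \oo] --> 0.
Proof.
move=> g0 f0 ig if_ gf Igf.
pose m n x := Num.max 0 (f x - g n x).
have mg n : measurable_fun setT (g n) by apply/measurable_EFinP; exact: measurable_int (ig n).
have mf : measurable_fun setT f by apply/measurable_EFinP; exact: measurable_int if_.
have mm n : measurable_fun setT (m n).
  by apply: measurable_maxr => //; exact: measurable_funB.
have m0 n x : 0 <= m n x by rewrite le_max lexx.
have mf' n x : m n x <= f x.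
  by rewrite ge_max f0/= gerBl.
have im n : mu.-integrable setT (EFin \o m n).
  apply: (@le_integrable _ _ _ mu _ measurableT _ (EFin \o f)) => //.
    exact/measurable_EFinP.
  by move=> x _ /=; rewrite lee_fin !ger0_norm.
have absE n : \int[mu]_x `|g n x - f x| =
    \int[mu]_x g n x - \int[mu]_x f x + 2 * \int[mu]_x m n x.
  have i2 : mu.-integrable setT (EFin \o (fun x => 2 * m n x)).
    by have := integrableZl measurableT 2 (im n).
  have ib : mu.-integrable setT (EFin \o (fun x => g n x - f x)).
    by have := integrableB measurableT (ig n) if_.
  rewrite -RintegralB// -RintegralZl// -RintegralD//.
  apply: eq_Rintegral => x _; rewrite /m.
  have [fg|gf'] := leP 0 (f x - g n x).
    by rewrite ler0_norm; lra.
  by rewrite ger0_norm; lra.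
have Im : \int[mu]_x m n x @[n --> \oo] --> 0.
  have [|||||_ _] := @dominated_convergence _ _ _ mu setT measurableT
    (fun n x => (m n x)%:E) (cst 0%E) (EFin \o f).
  - by move=> n; exact/measurable_EFinP.
  - exact: measurable_cst.
  - apply: filterS gf => x gfx _.
    apply: cvg_EFin; first exact: nearW.
    rewrite [X in _ --> X](_ : _ = Num.max 0 (f x - f x)); last first.
      by rewrite subrr maxxx.
    apply: (@continuous_cvg _ _ _ _ _ _ (fun t => Num.max 0 (f x - t))) => //.
    apply: continuous_max; first exact: cst_continuous.
    by move=> t; apply: cvgB; [exact: cvg_cst|exact: cvg_id].
  - exact: if_.
  - by apply: aeW => x n _; rewrite lee_fin ger0_norm.
  rewrite integral0 => H.
  exact: (@fine_cvg _ _ _ _ _ 0 H).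
under eq_fun do rewrite absE.
have H : \int[mu]_x g n x - \int[mu]_x f x + 2 * \int[mu]_x m n x
    @[n --> \oo] --> \int[mu]_x f x - \int[mu]_x f x + 2 * 0.
  apply: cvgD; first by apply: cvgB => //; exact: cvg_cst.
  by apply: cvgM => //; exact: cvg_cst.
by rewrite subrr mulr0 addr0 in H.
Qed.

Section sections.
Context {R : realType} {d : nat}.
Local Notation T := (measurableTypeR R * 'rV[R]_d)%type.
Variables (Q : probability T R) (p : R * 'rV[R]_d -> R).
Hypothesis Qp : has_density Q (@lebesgue_measure R \x lebesgue_rV d)%E p.

Definition section_below (o : option R) (x : 'rV[R]_d) : R :=
  \int[@lebesgue_measure R]_y (below o y * p (y, x)).

Lemma section_belowT x : section_below None x = marginal p x.
Proof. by apply: eq_Rintegral => y _; rewrite /= mul1r. Qed.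

Lemma section_below_itv t x :
  section_below (Some t) x = \int[@lebesgue_measure R]_(y in `]-oo, t]) p (y, x).
Proof.
rewrite [RHS]Rintegral_mkcond; apply: eq_Rintegral => y _.
rewrite /= patchE mem_setE in_itv/=.
by case: (y <= t); rewrite ?mul1r ?mul0r.
Qed.

Let p0 u : 0 <= p u. Proof. by have [_ + _] := Qp. Qed.

Let mp : measurable_fun setT (p : T -> R). Proof. by have [] := Qp. Qed.

Let msection x : measurable_fun setT (fun y : measurableTypeR R => p (y, x)).
Proof. exact: (measurableT_comp mp (pair2_measurable x)). Qed.

(** [marginal] takes the value 0 where the integral diverges. *)
Lemma section_integrable x : 0 < marginal p x ->
  (@lebesgue_measure R).-integrable setT (fun y => (p (y, x))%:E).
Proof.
rewrite /marginal /Rintegral => px; apply/integrableP; split.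
  exact/measurable_EFinP.
under eq_integral do rewrite /= ger0_norm//.
move: px; case: (integral _ _ _) => [r||]//=; rewrite ?ltry ?ltxx//.
Qed.

Lemma section_below_integrable o x : 0 < marginal p x ->
  (@lebesgue_measure R).-integrable setT (fun y => (below o y * p (y, x))%:E).
Proof.
move=> /section_integrable; apply: le_integrable => //.
  apply/measurable_EFinP; apply: measurable_funM => //.
  exact: (@measurable_below _ o).
move=> y _; rewrite lee_fin normrM ler_piMl//.
by have /andP[? ?] := below01 o y; rewrite ger0_norm.
Qed.

Lemma section_below_ge0 o x : 0 <= section_below o x.
Proof.
apply: Rintegral_ge0 => y _; rewrite mulr_ge0//.
by have /andP[] := below01 o y.
Qed.

Lemma section_below_le o x : 0 < marginal p x ->
  section_below o x <= marginal p x.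
Proof.
move=> px; apply: le_Rintegral => //.
- exact: section_below_integrable.
- exact: section_integrable.
by move=> y _; rewrite ler_piMl//; have /andP[] := below01 o y.
Qed.

Lemma section_below_dist o x z : 0 < marginal p x -> 0 < marginal p z ->
  `|section_below o x - section_below o z| <=
  \int[@lebesgue_measure R]_y `|p (y, x) - p (y, z)|.
Proof.
move=> px pz; rewrite /section_below -RintegralB//; last 2 first.
- exact: section_below_integrable.
- exact: section_below_integrable.
have ib : (@lebesgue_measure R).-integrable setT
    (EFin \o (fun y => below o y * p (y, x) - below o y * p (y, z))).
  exact: (integrableB measurableT (section_below_integrable o px)
    (section_below_integrable o pz)).
have id : (@lebesgue_measure R).-integrable setT
    (EFin \o (fun y => p (y, x) - p (y, z))).
  exact: (integrableB measurableT (section_integrable px) (section_integrable pz)).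
apply: le_trans (le_normr_Rintegral _ _) _ => //.
apply: le_Rintegral => //.
- exact: (integrable_norm ib).
- exact: (integrable_norm id).
move=> y _; rewrite -mulrBr normrM ler_piMl//.
by have /andP[? ?] := below01 o y; rewrite ger0_norm.
Qed.

(** Sections of p may fail to be integrable off the support of [psi], but there
    the factor [psi x] is 0. *)
Lemma integral_below_mul o (psi : 'rV[R]_d -> R) (c : R) :
  measurable_fun setT psi -> (forall x, `|psi x| <= c) ->
  (forall x, psi x != 0 -> 0 < marginal p x) ->
  (lebesgue_rV d).-integrable setT (fun x => (psi x * section_below o x)%:E) /\
  \int[Q]_z (below o z.1 * psi z.2) =
  \int[lebesgue_rV d]_x (psi x * section_below o x).
Proof.
move=> mpsi psic psi_supp.
pose phi (z : T) := below o z.1 * psi z.2.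
have mphi : measurable_fun setT phi.
  apply: measurable_funM.
    exact: (measurableT_comp (@measurable_below _ o) measurable_fst).
  exact: (measurableT_comp mpsi measurable_snd).
have phic z : `|phi z| <= c.
  rewrite normrM (le_trans _ (psic z.2))// ler_piMl//.
  by have /andP[? ?] := below01 o z.1; rewrite ger0_norm.
have [iG EG] := @product_density_fubini R _ _ _ _ (@lebesgue_measure R)
  (lebesgue_rV d) Q p phi c Qp mphi phic.
have GE : (fun x => \int[@lebesgue_measure R]_y (phi (y, x) * p (y, x))%:E)%E =
    (fun x => (psi x * section_below o x)%:E).
  apply/funext => x; rewrite /phi/=.
  have [px0|/psi_supp px] := eqVneq (psi x) 0.
    rewrite px0 mul0r integral0_eq// => y _.
    by rewrite mulr0 mul0r.
  have ibx := section_below_integrable o px.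
  rewrite EFinM /section_below fineK; last exact: integrable_fin_num.
  rewrite -integralZl//; apply: eq_integral => y _.
  by rewrite -EFinM mulrCA mulrA.
rewrite -GE; split; first exact: iG.
by rewrite /Rintegral EG -GE.
Qed.

End sections.

(** * Functions supported in a cube *)

Section cubes.
Context {R : realType} {n : nat}.
Implicit Types (z : 'rV[R]_n) (s c : R) (psi : 'rV[R]_n -> R).

Definition centered_cube z s : set 'rV[R]_n := [set x | `|x - z| <= s / 2].

Lemma centered_cubeE z s : 0 < s -> centered_cube z s =
  [set x : 'rV[R]_n | forall i, `[z ord0 i - s / 2, z ord0 i + s / 2]%classic (x ord0 i)].
Proof.
move=> s0; have s20 : 0 <= s / 2 by rewrite divr_ge0// ltW.
apply/seteqP; split=> x /=.
  by move=> /(rV_norm_leP _ s20) H i; rewrite /= in_itv/= -ler_distl;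
    have := H i; rewrite !mxE.
move=> H; apply/(rV_norm_leP _ s20) => i.
by rewrite !mxE ler_distl; have := H i; rewrite /= in_itv.
Qed.

Lemma measurable_centered_cube z s : 0 < s -> measurable (centered_cube z s).
Proof.
move=> s0; rewrite centered_cubeE// measurable_boxesE; apply: sub_sigma_algebra.
by exists (fun i => `[z ord0 i - s / 2, z ord0 i + s / 2]%classic).
Qed.

Lemma lebesgue_centered_cube z s : 0 < s ->
  lebesgue_rV n (centered_cube z s) = (s ^+ n)%:E.
Proof.
move=> s0; rewrite centered_cubeE//.
rewrite (@lebesgue_rV_box _ _ (fun i => `[z ord0 i - s / 2, z ord0 i + s / 2]%classic))//.
rewrite (eq_bigr (fun=> s%:E)); first by rewrite prodEFin prodr_const card_ord.
move=> i _; rewrite lebesgue_measure_itv/= lte_fin ifT; last by lra.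
by rewrite -EFinB; congr EFin; lra.
Qed.

(** A bounded function on a set of finite measure. *)
Lemma cube_supported_integrable psi z s c : 0 < s -> measurable_fun setT psi ->
  (forall x, `|psi x| <= c) -> (forall x, psi x != 0 -> centered_cube z s x) ->
  (lebesgue_rV n).-integrable setT (EFin \o psi).
Proof.
move=> s0 mpsi psic supp.
have mB := measurable_centered_cube z s0.
have iB : (lebesgue_rV n).-integrable (centered_cube z s) (EFin \o psi).
  apply: measurable_bounded_integrable => //.
  - by rewrite [X in (X < _)%E]lebesgue_centered_cube// ltry.
  - exact: measurable_funTS.
  - exists c; split; first exact: num_real.
    by move=> M cM x _; exact: le_trans (psic x) (ltW cM).
move/(integrable_mkcond _ mB) : iB; rewrite (_ : _ \_ _ = EFin \o psi)//.
apply/funext => x; rewrite patchE; case: ifPn => // /negP xB.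
have [p0|/supp xB'] := eqVneq (psi x) 0; first by rewrite /= p0.
by exfalso; apply: xB; rewrite inE.
Qed.

Lemma ge0_integral_reflect_scale psi z s : 0 < s -> measurable_fun setT psi ->
  (forall x, 0 <= psi x) ->
  (\int[lebesgue_rV n]_x (psi (s^-1 *: (z - x)))%:E =
   (s ^+ n)%:E * \int[lebesgue_rV n]_x (psi x)%:E)%E.
Proof.
move=> s0 mpsi psi0.
have mphi : measurable_fun setT (fun x : 'rV[R]_n => s^-1 *: (z - x)).
  exact: measurable_reflect.
have sn0 : 0 <= s ^+ n by rewrite exprn_ge0// ltW.
have mEpsi : measurable_fun setT (EFin \o psi) by exact/measurable_EFinP.
have := @ge0_integral_pushforward _ _ _ _ _ _ mphi (lebesgue_rV n) setT
  (EFin \o psi) measurableT mEpsi (fun x _ => psi0 x).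
rewrite preimage_setT => <-.
have := @ge0_integral_mscale _ _ _ (lebesgue_rV n) setT measurableT (NngNum sn0)
  (EFin \o psi) mEpsi (fun x _ => psi0 x).
move=> <-; apply: eq_measure_integral => A mA _.
exact: lebesgue_rV_reflect_scale.
Qed.

(** The formula for nonnegative functions, applied to the positive and the
    negative part. *)
Lemma integral_reflect_scale psi z s : 0 < s ->
  (lebesgue_rV n).-integrable setT (EFin \o psi) ->
  \int[lebesgue_rV n]_x psi (s^-1 *: (z - x)) =
  s ^+ n * \int[lebesgue_rV n]_x psi x.
Proof.
move=> s0 ipsi.
have mpsi : measurable_fun setT psi by apply/measurable_EFinP; exact: measurable_int ipsi.
have mphi : measurable_fun setT (fun x : 'rV[R]_n => s^-1 *: (z - x)).
  exact: measurable_reflect.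
pose pos x := Num.max (psi x) 0; pose neg x := Num.max (- psi x) 0.
have mpos : measurable_fun setT pos by apply: measurable_maxr.
have mneg : measurable_fun setT neg.
  by apply: measurable_maxr => //; exact: measurableT_comp.
have pos0 x : 0 <= pos x by rewrite le_max lexx orbT.
have neg0 x : 0 <= neg x by rewrite le_max lexx orbT.
have psiE x : psi x = pos x - neg x.
  by rewrite /pos /neg; have [?|?] := leP 0 (psi x);
    [rewrite max_r|rewrite [X in _ - X]max_l]; lra.
have dominated (g : 'rV[R]_n -> R) : measurable_fun setT g -> (forall x, 0 <= g x) ->
    (forall x, g x <= `|psi x|) ->
    [/\ (lebesgue_rV n).-integrable setT (EFin \o g),
    (lebesgue_rV n).-integrable setT (fun x => (g (s^-1 *: (z - x)))%:E) &
    \int[lebesgue_rV n]_x g (s^-1 *: (z - x)) = s ^+ n * \int[lebesgue_rV n]_x g x].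
  move=> mg g0 gpsi.
  have ig : (lebesgue_rV n).-integrable setT (EFin \o g).
    apply: le_integrable ipsi => //; first exact/measurable_EFinP.
    by move=> x _; rewrite /= lee_fin ger0_norm.
  have Eg := ge0_integral_reflect_scale z s0 mg g0.
  split => //; last by rewrite /Rintegral Eg fineM// integrable_fin_num.
  apply/integrableP; split.
    by apply/measurable_EFinP; exact: (measurableT_comp mg mphi).
  under eq_integral do rewrite /= ger0_norm//.
  rewrite Eg lte_mul_pinfty ?lee_fin ?exprn_ge0 ?(ltW s0)//.
  by rewrite ltey_eq integrable_fin_num.
have [ipos iposz Epos] := dominated _ mpos pos0 (fun x =>
  ltac:(by rewrite ge_max normr_ge0 ler_norm)).
have [ineg inegz Eneg] := dominated _ mneg neg0 (fun x =>
  ltac:(by rewrite ge_max normr_ge0 -normrN ler_norm)).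
under eq_Rintegral do rewrite psiE.
rewrite RintegralB// Epos Eneg -mulrBr -RintegralB//.
by congr (_ * _); apply: eq_Rintegral => x _.
Qed.

End cubes.

(** * Uniform continuity of the sections *)

Section smoothing.
Context {R : realType} {d : nat}.
Local Notation T := (measurableTypeR R * 'rV[R]_d)%type.
Variables (Q : probability T R) (p : R * 'rV[R]_d -> R).
Hypothesis Qp : has_density Q (@lebesgue_measure R \x lebesgue_rV d)%E p.
Variables (I : set 'rV[R]_d) (eps : R).
Hypothesis I_compact : compact I.
Hypothesis eps_gt0 : 0 < eps.
Hypothesis f_continuous : {within closed_nbhd I eps, continuous (marginal p)}.
Hypothesis f_gt0 : forall z, closed_nbhd I eps z -> 0 < marginal p z.
Hypothesis p_continuous : forall z, closed_nbhd I eps z ->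
  {ae @lebesgue_measure R, forall y, p (y, z') @[z' --> z] --> p (y, z)}.

Lemma closed_nbhd_near z x : I z -> `|x - z| <= eps -> closed_nbhd I eps x.
Proof. by move=> Iz xz; exists z. Qed.

Lemma closed_nbhd_center z : I z -> closed_nbhd I eps z.
Proof. by move=> Iz; apply: (closed_nbhd_near Iz); rewrite subrr normr0 ltW. Qed.

(** Otherwise some sequence x_n -> z keeps a distance from p(., z) in L1. It
    stays in the neighborhood of I, where the marginal is continuous, so that
    Scheffe's lemma applies. *)
Lemma section_L1_continuous z (eta : R) : I z -> 0 < eta ->
  \forall x \near z,
    \int[@lebesgue_measure R]_y `|p (y, x) - p (y, z)| < eta.
Proof.
move=> Iz eta0; apply: contrapT => far.
have : forall n : nat, exists x, [/\ `|x - z| < n.+1%:R^-1, `|x - z| <= eps &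
    eta <= \int[@lebesgue_measure R]_y `|p (y, x) - p (y, z)|].
  move=> n; apply: contrapT => none; apply: far; apply/nbhs_normP.
  have e0 : 0 < Num.min n.+1%:R^-1 eps by rewrite lt_min invr_gt0 ltr0n/=.
  exists (Num.min n.+1%:R^-1 eps) => // x /=; rewrite distrC lt_min => /andP[xn xe].
  by rewrite ltNge; apply/negP => H; apply: none; exists x; split=> //; exact: ltW.
move=> /choice[x xP].
have xz : x n @[n --> \oo] --> z.
  apply/cvgrPdist_lt => e e0; near=> n; have [xn _ _] := xP n.
  rewrite distrC (lt_trans xn)//; near: n.
  exact: (near_infty_natSinv_lt (PosNum e0)).
have Jx n : closed_nbhd I eps (x n) by have [_ /(closed_nbhd_near Iz)] := xP n.
have Jz := closed_nbhd_center Iz.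
have p0 u : 0 <= p u by have [_ + _] := Qp.
have L1 : \int[@lebesgue_measure R]_y `|p (y, x n) - p (y, z)| @[n --> \oo] --> 0.
  apply: (@scheffe R _ (measurableTypeR R) (@lebesgue_measure R)
    (fun n y => p (y, x n)) (fun y => p (y, z))) => //.
  - by move=> n; apply: (section_integrable Qp); exact: f_gt0.
  - by apply: (section_integrable Qp); exact: f_gt0.
  - have [N [mN N0 sub]] := p_continuous Jz; exists N; split=> // y /= ncvg.
    by apply: sub => /= cvgy; apply: ncvg; exact: cvg_comp xz cvgy.
  - have /subspace_continuousP /(_ z Jz) fz := f_continuous.
    move=> B fzB.
    have zB : nbhs z [set u | closed_nbhd I eps u -> B (marginal p u)] := fz B fzB.
    have xB : \forall n \near \oo, closed_nbhd I eps (x n) -> B (marginal p (x n)).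
      exact: (xz _ zB).
    have : \forall n \near \oo, B (marginal p (x n)).
      by apply: filterS xB => n; apply; exact: Jx.
    exact.
have /cvgrPdist_lt /(_ eta eta0) [N _ /(_ N (leqnn N))] := L1.
rewrite /= sub0r normrN ger0_norm; last first.
  by apply: Rintegral_ge0 => y _.
by rewrite ltNge => /negP; apply; have [] := xP N.
Unshelve. all: by end_near. Qed.

(** Compactness of I makes the modulus of continuity uniform; the half-line does
    not matter since every section is within the L1 distance. *)
Lemma section_below_uniform (eta : R) : 0 < eta ->
  exists2 r, 0 < r <= eps & forall z x o, I z -> `|x - z| <= r ->
    `|section_below p o x - section_below p o z| <= eta.
Proof.
move=> eta0.
pose bad (r : R) z := forall x o, `|x - z| <= r ->
    `|section_below p o x - section_below p o z| <= eta.
have near_bad : \forall r \near 0^'+, I `<=` bad r.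
  apply: (compact_near_coveringP I).1 => // z Iz.
  have eta20 : 0 < eta / 2 by rewrite divr_gt0.
  have /nbhs_normP[e /= e0 He] := section_L1_continuous Iz eta20.
  pose m := Num.min e eps; have m0 : 0 < m by rewrite lt_min e0.
  have close x o : `|x - z| < m ->
      `|section_below p o x - section_below p o z| <= eta / 2.
    rewrite lt_min => /andP[xe xeps].
    apply: le_trans (section_below_dist Qp _ _ _) _.
    - by apply: f_gt0; apply: (closed_nbhd_near Iz); exact: ltW.
    - exact/f_gt0/closed_nbhd_center.
    by apply/ltW/He; rewrite /= distrC.
  have m20 : 0 < m / 2 by rewrite divr_gt0.
  have nz : \forall z' \near z, `|z - z'| < m / 2.
    by apply/nbhs_normP; exists (m / 2).
  exists ([set z' | `|z - z'| < m / 2], [set r | r < m / 2]); first split => /=.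
  - exact: nz.
  - exact: nbhs_right_lt.
  move=> [z' r] /= [zz' rm] x o xz'.
  have h1 : `|section_below p o x - section_below p o z| <= eta / 2.
    apply: close; rewrite (le_lt_trans (ler_distD z' _ _))//.
    by rewrite [m]splitr ler_ltD// ?(le_trans xz')// ?ltW// distrC.
  have h2 : `|section_below p o z' - section_below p o z| <= eta / 2.
    apply: close; rewrite distrC (lt_le_trans zz')//.
    by rewrite ler_pdivrMr// ler_peMr ?ler1n// ltW.
  rewrite (le_trans (ler_distD (section_below p o z) _ _))//.
  by rewrite [eta]splitr lerD// distrC.
have [r [r0 [re rI]]] : exists r, 0 < r /\ (r <= eps /\ I `<=` bad r).
  apply: (@filter_ex _ (0 : R)^'+); near=> r; split; first by [].
  by split; near: r => //; exact: nbhs_right_ltW.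
exists r; first by rewrite r0.
by move=> z x o Iz; exact: rI.
Unshelve. all: by end_near. Qed.

End smoothing.

(** * Means of the kernel sums *)

Section kernel_moments.
Context {R : realType} {d : nat}.
Local Notation T := (measurableTypeR R * 'rV[R]_d)%type.
Variables (Q : probability T R) (p : R * 'rV[R]_d -> R).
Hypothesis Qp : has_density Q (@lebesgue_measure R \x lebesgue_rV d)%E p.

(** After Fubini the mean of 1(y <= t) psi(x) is an integral of [psi] against
    sections that differ from the one at z by at most [eta] on the cube, whose
    volume is s ^ d. All means below are instances of this estimate. *)
Lemma smoothing_bias z (s c eta : R) o (psi : 'rV[R]_d -> R) :
  0 < s -> 0 <= eta -> measurable_fun setT psi -> (forall x, `|psi x| <= c) ->
  (forall x, psi x != 0 -> centered_cube z s x) ->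
  (forall x, centered_cube z s x -> 0 < marginal p x) ->
  (forall x, centered_cube z s x ->
    `|section_below p o x - section_below p o z| <= eta) ->
  `|\int[Q]_u (below o u.1 * psi u.2) -
    section_below p o z * \int[lebesgue_rV d]_x psi x| <= c * eta * s ^+ d.
Proof.
move=> s0 eta0 mpsi psic supp pos close.
have c0 : 0 <= c by exact: le_trans (psic 0).
have [iq Eq] := integral_below_mul Qp o mpsi psic (fun x px => pos x (supp x px)).
have ipsi := cube_supported_integrable s0 mpsi psic supp.
have iqz : (lebesgue_rV d).-integrable setT
    (EFin \o (fun x => psi x * section_below p o z)).
  have := integrableZr measurableT (section_below p o z) ipsi.
  by apply: eq_integrable => // x _; rewrite /= EFinM.
rewrite Eq mulrC -RintegralZr// -RintegralB//.
pose B := centered_cube z s; have mB : measurable B by exact: measurable_centered_cube.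
have ind_cube (x : 'rV[R]_d) : `|c * eta * \1_B x| <= c * eta.
  by rewrite ger0_norm ?mulr_ge0// ler_piMr ?mulr_ge0// indicE lern1 leq_b1.
have iB : (lebesgue_rV d).-integrable setT (EFin \o (fun x => c * eta * \1_B x)).
  apply: (@cube_supported_integrable _ _ _ z s (c * eta)) => //.
    by apply: measurable_funM => //; exact: measurable_indic.
  move=> x; rewrite indicE; case: (boolP (x \in B)) => [/set_mem//|_].
  by rewrite mulr0 eqxx.
have idiff : (lebesgue_rV d).-integrable setT
    (EFin \o (fun x => psi x * section_below p o x - psi x * section_below p o z)).
  exact: (integrableB measurableT iq iqz).
apply: le_trans (le_normr_Rintegral _ _) _ => //.
rewrite [leRHS](_ : _ = \int[lebesgue_rV d]_x (c * eta * \1_B x)); last first.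
  rewrite RintegralZl//; last first.
    apply: (@cube_supported_integrable _ _ _ z s 1) => //.
      by move=> x; rewrite ger0_norm// indicE lern1 leq_b1.
    move=> x; rewrite indicE; case: (boolP (x \in B)) => [/set_mem//|_].
    by rewrite eqxx.
  congr (_ * _); rewrite /Rintegral integral_indic// setIT.
  by rewrite [X in fine X]lebesgue_centered_cube.
apply: le_Rintegral => //; first exact: (integrable_norm idiff).
move=> x _; rewrite -mulrBr normrM indicE.
have [p0|/supp xB] := eqVneq (psi x) 0; first by rewrite p0 normr0 mul0r !mulr_ge0.
by rewrite mem_set// mulr1 ler_pM// close.
Qed.

Variable K : 'rV[R]_d -> R.
Hypothesis d_gt0 : (0 < d)%N.
Hypothesis K_regular : regular_kernel K.
Hypothesis K_support : forall s, K s != 0 -> forall i, `|s ord0 i| <= 2^-1.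

Let kappa := fine (sup_abs K).
Let side (h : R) := h `^ d%:R^-1.

Lemma side_gt0 h : 0 < h -> 0 < side h.
Proof. exact: powR_gt0. Qed.

Lemma side_expn h : 0 < h -> side h ^+ d = h.
Proof.
move=> h0; rewrite -powR_mulrn ?ltW ?side_gt0// -powRrM mulVf ?powRr1 ?ltW//.
by rewrite pnatr_eq0 -lt0n.
Qed.

Lemma rescale_support h z x : 0 < h -> rescale K h z x != 0 ->
  centered_cube z (side h) x.
Proof.
move=> h0 /K_support H; have s0 := side_gt0 h0.
rewrite centered_cubeE// => i /=; have := H i; rewrite !mxE -/(side h).
rewrite normrM normfV (gtr0_norm s0) ler_pdivrMl// distrC ler_distl in_itv/=.
by rewrite -[_ / 2]mulrC.
Qed.

Lemma kernel_integrable : (lebesgue_rV d).-integrable setT (EFin \o K).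
Proof.
apply: (@cube_supported_integrable _ _ _ 0 1 kappa) => //.
- exact: kernel_measurable.
- exact: kernel_le_sup.
move=> x /K_support H; apply/(rV_norm_leP _ _); first by rewrite divr_ge0.
by move=> i; rewrite !mxE subr0 div1r.
Qed.

Lemma integral_rescale h z : 0 < h ->
  \int[lebesgue_rV d]_x rescale K h z x = h.
Proof.
move=> h0; rewrite (integral_reflect_scale z (side_gt0 h0) kernel_integrable).
rewrite side_expn// /Rintegral (kernel_integral K_regular) mulr1//.
Qed.

Section at_point.
Variables (z : 'rV[R]_d) (h eta : R).
Hypothesis h0 : 0 < h.
Hypothesis eta0 : 0 <= eta.
Hypothesis pos : forall x, centered_cube z (side h) x -> 0 < marginal p x.
Hypothesis close : forall x o, centered_cube z (side h) x ->
    `|section_below p o x - section_below p o z| <= eta.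

Let cube_z : centered_cube z (side h) z.
Proof. by rewrite /centered_cube/= subrr normr0 divr_ge0// ltW// side_gt0. Qed.

Lemma kernel_mean o :
  `|\int[Q]_u (below o u.1 * rescale K h z u.2) - section_below p o z * h| <=
  kappa * eta * h.
Proof.
rewrite -{2}(integral_rescale z h0) -[in leRHS](side_expn h0).
apply: smoothing_bias => //.
- exact: side_gt0.
- exact: measurable_rescale.
- by move=> x; exact: rescale_le_sup.
- by move=> x; exact: rescale_support.
- by move=> x; exact: close.
Qed.

(** F(t|z) is the ratio of the sections at z for t and for the whole line, so
    that the main terms of the two means cancel. *)
Lemma kernel_mean_cond_cdf t :
  `|\int[Q]_u (below (Some t) u.1 * rescale K h z u.2) -
    cond_cdf p t z * \int[Q]_u (below None u.1 * rescale K h z u.2)| <=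
  2 * (kappa * eta * h).
Proof.
have fz := pos cube_z.
have q0 := section_below_ge0 Qp (Some t) z.
have qf := section_below_le Qp (Some t) fz.
have H1 := kernel_mean (Some t); have H2 := kernel_mean None.
rewrite section_belowT in H2.
have cE : cond_cdf p t z = section_below p (Some t) z / marginal p z.
  by rewrite section_below_itv.
have c0 : 0 <= cond_cdf p t z by rewrite cE divr_ge0// ltW.
have c1 : cond_cdf p t z <= 1 by rewrite cE ler_pdivrMr// mul1r.
have cf : cond_cdf p t z * marginal p z = section_below p (Some t) z.
  by rewrite cE divfK// gt_eqF.
move: H1 H2; rewrite -cf.
set A := \int[Q]_u _; set C := \int[Q]_u _; set e := kappa * eta * h => H1 H2.
have -> : A - cond_cdf p t z * C = (A - cond_cdf p t z * marginal p z * h) -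
  cond_cdf p t z * (C - marginal p z * h) by ring.
rewrite (le_trans (ler_normB _ _))// mulr_natl mulr2n lerD// normrM.
by rewrite (ger0_norm c0) (le_trans _ H2)// ler_piMl.
Qed.

(** Both functions are bounded by 1 and vanish outside the cube, so their means
    are at most the probability that X lies in the cube. *)
Lemma kernel_second_moment o b :
  \int[Q]_u (halfline_kernel K o b (rescale K h z) u ^+ 2) <= (marginal p z + eta) * h /\
  \int[Q]_u (halfline_kernel K o true (rescale K h z) u) <= (marginal p z + eta) * h.
Proof.
pose B := centered_cube z (side h).
have mB : measurable B by apply: measurable_centered_cube; exact: side_gt0.
have B1 (x : 'rV[R]_d) : `|\1_B x : R| <= 1.
  by rewrite ger0_norm// indicE lern1 leq_b1.
have mass : \int[Q]_u (below None u.1 * \1_B u.2) <= (marginal p z + eta) * h.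
  have := @smoothing_bias z (side h) 1 eta None \1_B.
  rewrite section_belowT side_expn//.
  have -> : \int[lebesgue_rV d]_x \1_B x = h.
    rewrite /Rintegral integral_indic// setIT [X in fine X]lebesgue_centered_cube.
      by rewrite /= side_expn.
    exact: side_gt0.
  move=> /(_ (side_gt0 h0) eta0 (measurable_indic mB) B1) H.
  have {}H : `|\int[Q]_u (below None u.1 * \1_B u.2) - marginal p z * h| <= 1 * eta * h.
    apply: H => // [x|x xB].
      by rewrite indicE; case: (boolP (x \in B)) => [/set_mem//|_]; rewrite eqxx.
    by rewrite -section_belowT; exact: close.
  move: H; rewrite ler_distl mul1r => /andP[_].
  by rewrite mulrDl.
have Kg : kernel_class K (rescale K h z) by exists h, z.
have imass : Q.-integrable setT (EFin \o (fun u : T => below None u.1 * \1_B u.2)).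
  apply: (@bounded_integrable _ _ _ Q (fun u : T => below None u.1 * \1_B u.2) 1).
    apply: measurable_funM; first exact: measurable_cst.
    exact: (measurableT_comp (measurable_indic mB) measurable_snd).
  by move=> u; rewrite /= mul1r.
have bound (f : T -> R) : measurable_fun setT f -> (forall u, `|f u| <= 1) ->
    (forall u, rescale K h z u.2 = 0 -> f u = 0) ->
    \int[Q]_u f u <= (marginal p z + eta) * h.
  move=> mf f1 f0; apply: le_trans mass; apply: le_Rintegral => //.
    exact: (bounded_integrable _ mf f1).
  move=> u _; rewrite /= mul1r indicE.
  have [/f0 ->|/(rescale_support h0) xB] := eqVneq (rescale K h z u.2) 0 => //.
  by rewrite mem_set// (le_trans (ler_norm _)).
split; apply: bound.
- by apply: measurable_funX; exact: measurable_slab.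
- by move=> u; rewrite normrX exprn_ile1// halfline_kernel_le1.
- by move=> u u0; rewrite /halfline_kernel u0 mul0r expr0n/= mulr0 expr0n.
- exact: measurable_slab.
- by move=> u; rewrite halfline_kernel_le1.
- by move=> u u0; rewrite /halfline_kernel u0 mul0r expr0n/= mulr0.
Qed.

End at_point.
End kernel_moments.

(** * From sums to the ratio *)

Section kernel_sums.
Context {R : realType} {d : nat}.
Local Notation T := (measurableTypeR R * 'rV[R]_d)%type.
Variables (Q : probability T R) (K : 'rV[R]_d -> R).
Hypothesis K_regular : regular_kernel K.
Let kappa := fine (sup_abs K).

(** The square of the normalized function with [b = false] is the one with
    [b = true], which dominates its own square. Its deviation inequality
    therefore bounds the empirical second moment in terms of itself, with a
    factor dl <= 1/2 that can be absorbed. *)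
Lemma sum_deviation (g : 'rV[R]_d -> R) (x : nat -> T) (n : nat) (a dl V h : R) o :
  kernel_class K g -> 0 < dl <= 2^-1 -> a <= h ->
  \int[Q]_u (halfline_kernel K o false g u ^+ 2) <= V ->
  \int[Q]_u (halfline_kernel K o true g u ^+ 2) <= V ->
  \int[Q]_u halfline_kernel K o true g u <= V ->
  (forall b, `|\sum_(i < n) halfline_kernel K o b g (x i) -
      n%:R * \int[Q]_z halfline_kernel K o b g z| <=
    dl * (n%:R * \int[Q]_z (halfline_kernel K o b g z ^+ 2) +
      \sum_(i < n) halfline_kernel K o b g (x i) ^+ 2 + n%:R * a)) ->
  `|\sum_(i < n) below o (x i).1 * g (x i).2 -
    n%:R * \int[Q]_u (below o u.1 * g u.2)| <= dl * (n%:R * (kappa * (4 * V + 2 * h))).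
Proof.
move=> Kg /andP[dl0 dl2] ah V1 V2 V3 dev.
have kappa0 : 0 < kappa by exact: kernel_sup_gt0.
have n0 : 0 <= n%:R :> R by [].
have slabE u : below o u.1 * g u.2 = kappa * halfline_kernel K o false g u.
  rewrite /halfline_kernel expr1 -/kappa; field; by rewrite gt_eqF.
have -> : \sum_(i < n) below o (x i).1 * g (x i).2 =
    kappa * \sum_(i < n) halfline_kernel K o false g (x i).
  by rewrite mulr_sumr; apply: eq_bigr => i _; exact: slabE.
have mslab := measurable_slab K_regular o false Kg.
have islab : Q.-integrable setT (EFin \o halfline_kernel K o false g).
  by apply: (bounded_integrable _ mslab (fun u => halfline_kernel_le1 K_regular o false u Kg)).
have -> : \int[Q]_u (below o u.1 * g u.2) = kappa * \int[Q]_u halfline_kernel K o false g u.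
  by under eq_Rintegral do rewrite slabE; rewrite RintegralZl.
rewrite mulrCA -mulrBr normrM (gtr0_norm kappa0).
have sq u : halfline_kernel K o false g u ^+ 2 = halfline_kernel K o true g u.
  rewrite /halfline_kernel exprMn -exprM; congr (_ * _).
  by case: o {slabE mslab islab V1 V2 V3 dev} => [t|]/=;
    [case: (u.1 <= t)|]; rewrite ?expr1n ?expr0n.
have slab01 u : 0 <= halfline_kernel K o true g u <= 1.
  rewrite -sq sqr_ge0/= -real_normK ?num_real// expr_le1//.
  exact: halfline_kernel_le1.
have D1 := dev false; have D2 := dev true.
have X0 : 0 <= \sum_(i < n) halfline_kernel K o true g (x i).
  by apply: sumr_ge0 => i _; have /andP[] := slab01 (x i).
have X2 : \sum_(i < n) halfline_kernel K o true g (x i) ^+ 2 <=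
    \sum_(i < n) halfline_kernel K o true g (x i).
  apply: ler_sum => i _; have /andP[s0 s1] := slab01 (x i).
  by rewrite expr2 ler_piMr.
have E1 : \sum_(i < n) halfline_kernel K o false g (x i) ^+ 2 =
    \sum_(i < n) halfline_kernel K o true g (x i).
  by apply: eq_bigr => i _; exact: sq.
rewrite E1 in D1.
rewrite [leRHS](_ : _ = kappa * (dl * (n%:R * (4 * V + 2 * h)))); last by ring.
rewrite ler_pM2l// (le_trans D1)// ler_pM2l//.
move: D2; rewrite ler_distl => /andP[_ D2].
have nV1 := ler_wpM2l n0 V1; have nV2 := ler_wpM2l n0 V2.
have nV3 := ler_wpM2l n0 V3; have na := ler_wpM2l n0 ah.
set X := \sum_(i < n) halfline_kernel K o true g (x i) in X0 X2 D2 *.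
have bnd : dl * (n%:R * \int[Q]_z (halfline_kernel K o true g z ^+ 2) +
    \sum_(i < n) halfline_kernel K o true g (x i) ^+ 2 + n%:R * a) <=
    2^-1 * (n%:R * V + X + n%:R * h).
  apply: ler_pM => //; first exact: ltW.
    rewrite -(pmulr_rge0 _ dl0); apply: le_trans (dev true) => //.
  by rewrite lerD// lerD.
have X3 : X <= 3 * (n%:R * V) + n%:R * h by move: D2 nV3 bnd; clear; lra.
rewrite [leRHS](_ : _ = 4 * (n%:R * V) + 2 * (n%:R * h)); last by ring.
by move: X3 nV1 na; clear; lra.
Qed.

End kernel_sums.

(** N / D - F = (N - F D) / D, where the denominator is at least n h m / 2. *)
Lemma ratio_deviation {R : realType} (N D n h Et E0 F f m e ee rho : R) :
  0 < n -> 0 < h -> 0 < m -> m <= f -> 0 <= F <= 1 ->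
  `|N - n * Et| <= e * (n * h) -> `|D - n * E0| <= e * (n * h) ->
  `|Et - F * E0| <= 2 * (ee * h) -> `|E0 - f * h| <= ee * h ->
  0 <= e -> 0 <= ee -> e <= m / 4 -> ee <= m / 4 ->
  e <= rho * m / 8 -> ee <= rho * m / 8 ->
  `|N / D - F| <= rho.
Proof.
move=> n0 h0 m0 mf /andP[F0 F1] HN HD HE H0 e0 ee0 em eem er eer.
have nh0 : 0 < n * h by rewrite mulr_gt0.
have Dlow : n * h * (m / 2) <= D.
  move: HD H0; rewrite !ler_distl => /andP[HD _] /andP[H0 _].
  have h1 : n * (f * h - ee * h) <= n * E0 by rewrite ler_pM2l.
  have h2 : n * h * m <= n * h * f by rewrite ler_pM2l.
  have h3 : n * h * ee <= n * h * (m / 4) by rewrite ler_pM2l.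
  have h4 : n * h * e <= n * h * (m / 4) by rewrite ler_pM2l.
  lra.
have D0 : 0 < D by rewrite (lt_le_trans _ Dlow)// !mulr_gt0// divr_gt0.
have -> : N / D - F = (N - F * D) / D by field; rewrite gt_eqF.
rewrite normrM normfV (gtr0_norm D0) ler_pdivrMr//.
have num : `|N - F * D| <= n * h * (2 * e + 2 * ee).
  have -> : N - F * D = (N - n * Et) + n * (Et - F * E0) - F * (D - n * E0) by ring.
  apply: (@le_trans _ _ (e * (n * h) + n * (2 * (ee * h)) + e * (n * h))); last by lra.
  rewrite (le_trans (ler_normB _ _))// lerD//.
    rewrite (le_trans (ler_normD _ _))// lerD// normrM (gtr0_norm n0).
    by rewrite ler_pM2l.
  by rewrite normrM (ger0_norm F0) (le_trans _ HD)// ler_piMl.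
have rho0 : 0 <= rho.
  have : 0 <= rho * m / 8 by exact: le_trans er.
  by rewrite pmulr_lge0 ?invr_gt0// pmulr_lge0.
apply: (le_trans num); apply: (@le_trans _ _ (rho * (n * h * (m / 2)))).
  have h1 : n * h * e <= n * h * (rho * m / 8) by rewrite ler_pM2l.
  have h2 : n * h * ee <= n * h * (rho * m / 8) by rewrite ler_pM2l.
  lra.
by rewrite ler_wpM2l.
Qed.

Lemma compact_bounds {R : realType} d (A : set 'rV[R]_d) (f : 'rV[R]_d -> R) :
  compact A -> {within A, continuous f} -> (forall z, A z -> 0 < f z) ->
  exists m M, [/\ 0 < m, 0 < M & forall z, A z -> m <= f z <= M].
Proof.
move=> cA cf f0; have [->|/set0P A0] := eqVneq A set0.
  by exists 1, 1; split.
have [u uA fu] := compact_EVT_min A0 cA cf.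
have [v vA fv] := compact_EVT_max A0 cA cf.
exists (f u), (f v); split; [exact/f0/set_mem|exact/f0/set_mem|].
by move=> z /mem_set Az; rewrite fu// fv.
Qed.

Lemma emp_cond_cdfE {R : realType} d (K : 'rV[R]_d -> R) (yx : nat -> R * 'rV[R]_d)
    n h t z : emp_cond_cdf K yx n h t z =
  (\sum_(i < n) below (Some t) (yx i.+1).1 * rescale K h z (yx i.+1).2) /
  (\sum_(i < n) below None (yx i.+1).1 * rescale K h z (yx i.+1).2).
Proof.
rewrite /emp_cond_cdf !big_add1/= !big_mkord; congr (_ / _).
  by apply: eq_bigr => i _; rewrite /= indicE mem_setE in_itv.
by apply: eq_bigr => i _; rewrite mul1r.
Qed.

Lemma nnsup_le {R : realType} (T : Type) (A : set T) (f : T -> \bar R) (c : \bar R) :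
  (0 <= c)%E -> (forall x, A x -> (f x <= c)%E) -> (nnsup A f <= c)%E.
Proof.
move=> c0 fc; apply: ge_ereal_sup => _ [->//|[x Ax <-]]; exact: fc.
Qed.

Lemma nnsup_ge0 {R : realType} (T : Type) (A : set T) (f : T -> \bar R) :
  (0 <= nnsup A f)%E.
Proof. by apply: ereal_sup_ubound; left. Qed.

Theorem corollary3 (R : realType) (d : nat) (d_gt0 : (0 < d)%N)
    (disp : measure_display) (Omega : measurableType disp)
    (P : probability Omega R)
    (YX : nat -> {RV P >-> (measurableTypeR R * 'rV[R]_d)%type})
    (YX_iid : iid P YX)
    (p : R * 'rV[R]_d -> R)
    (p_density : has_density (distribution P (YX 0%N))
                   (@lebesgue_measure R \x lebesgue_rV d)%E p)
    (I : set 'rV[R]_d) (I_compact : compact I)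
    (K : 'rV[R]_d -> R) (K_regular : regular_kernel K)
    (K_support : forall s, K s != 0 -> forall i, `|s ord0 i| <= 2^-1)
    (eps : R) (eps_gt0 : 0 < eps)
    (f_continuous : {within closed_nbhd I eps, continuous (marginal p)})
    (f_gt0 : forall z, closed_nbhd I eps z -> 0 < marginal p z)
    (p_continuous : forall z, closed_nbhd I eps z ->
       {ae @lebesgue_measure R, forall y, p (y, z') @[z' --> z] --> p (y, z)})
    (a b : nat -> R)
    (ab : forall n, 0 < a n /\ a n < b n /\ b n < 1)
    (b_cvg0 : b n @[n --> \oo] --> 0)
    (na_cvgy : (n%:R * a n / ln (n%:R : R)) @[n --> \oo] --> +oo) :
  {ae P, forall w,
    nnsup [set` `[a n, b n]] (fun h => nnsup I (fun z => nnsup setT (fun t =>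
      `|emp_cond_cdf K (fun i => YX i w) n h t z - cond_cdf p t z|%:E)))
    @[n --> \oo] --> 0%E}.
Proof.
set kappa := fine (sup_abs K).
have kappa0 : 0 < kappa by exact: kernel_sup_gt0.
have a01 n : 0 < a n < 1.
  by have [? [ablt b1]] := ab n; apply/andP; split=> //; exact: lt_trans b1.
have ISub : I `<=` closed_nbhd I eps by move=> z; exact: closed_nbhd_center.
have [m [M [m0 M0 fmM]]] := compact_bounds I_compact
  (continuous_subspaceW ISub f_continuous) (fun z Iz => f_gt0 _ (ISub z Iz)).
pose dl (k : nat) : R := k.+2%:R^-1.
have dl0 k : 0 < dl k by rewrite invr_gt0.
have dl2 k : dl k <= 2^-1 by rewrite lef_pV2 ?posrE// ler_nat.
have : \forall w \ae P, forall k, \forall n \near \oo,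
    forall o c g, kernel_class K g ->
    `|\sum_(i < n) halfline_kernel K o c g (YX i.+1 w) -
      n%:R * \int[distribution P (YX 0%N)]_z halfline_kernel K o c g z| <=
    dl k * (n%:R * \int[distribution P (YX 0%N)]_z (halfline_kernel K o c g z ^+ 2) +
      \sum_(i < n) halfline_kernel K o c g (YX i.+1 w) ^+ 2 + n%:R * a n).
  apply: ae_foralln => k; apply: (halfline_kernel_deviation YX_iid K_regular a01 na_cvgy).
  by rewrite dl0 (le_trans (dl2 k))// invf_le1// ler1n.
apply: filterS => w dev.
set S := fun n : nat => nnsup _ _.
have S0 n : (0 <= S n)%E by exact: nnsup_ge0.
suff small : forall rho : R, 0 < rho -> \forall n \near \oo, (S n <= rho%:E)%E.
  apply/fine_cvgP; split.
    apply: filterS (small 1 ltr01) => n Sn.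
    by rewrite ge0_fin_numE// (le_lt_trans Sn)// ltry.
  apply/cvgrPdist_le => rho rho0; apply: filterS (small rho rho0) => n Sn.
  rewrite /= sub0r normrN ger0_norm ?fine_ge0// -lee_fin fineK//.
  by rewrite ge0_fin_numE// (le_lt_trans Sn)// ltry.
move=> rho rho0.
(* Since [eta <= 1] below, second moments are at most (M + eta) h <= B h. *)
pose B := M + 1; have B0 : 0 < B by rewrite addr_gt0.
pose C := kappa * (4 * B + 2).
have C0 : 0 < C by rewrite mulr_gt0// addr_gt0// mulr_gt0.
(* [tau] is to bound the relative errors of the means and of the fluctuations:
   below m / 4 they keep the denominator above n h m / 2, and below rho m / 8
   they make the error of the ratio at most rho. *)
pose tau := Num.min (m / 4) (rho * m / 8).
have tau0 : 0 < tau by rewrite lt_min !divr_gt0// mulr_gt0.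
pose eta := Num.min 1 (tau / kappa).
have eta0 : 0 < eta by rewrite lt_min ltr01 divr_gt0.
have [r /andP[r0 reps] close] := section_below_uniform p_density I_compact eps_gt0
  f_continuous f_gt0 p_continuous eta0.
have [k kP] : exists k, dl k * C <= tau.
  have tC : 0 < tau / C by rewrite divr_gt0.
  have [N _ /(_ N (leqnn N)) NP] := near_infty_natSinv_lt (PosNum tC).
  exists N; rewrite -ler_pdivlMr//; apply: le_trans (ltW NP).
  by rewrite lef_pV2 ?posrE// ler_nat.
have b_small : \forall n \near \oo, b n <= (2 * r) ^+ d.
  have rd : 0 < (2 * r) ^+ d by rewrite exprn_gt0// mulr_gt0.
  have /cvgrPdist_le /(_ _ rd) := b_cvg0; apply: filterS => i.
  by rewrite sub0r normrN; apply: le_trans; exact: ler_norm.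
near=> n.
have n0 : 0 < n%:R :> R by rewrite ltr0n; near: n; exact: nbhs_infty_gt.
have bn : b n <= (2 * r) ^+ d by near: n.
have devn : forall o c g, kernel_class K g ->
    `|\sum_(i < n) halfline_kernel K o c g (YX i.+1 w) -
      n%:R * \int[distribution P (YX 0%N)]_z halfline_kernel K o c g z| <=
    dl k * (n%:R * \int[distribution P (YX 0%N)]_z (halfline_kernel K o c g z ^+ 2) +
      \sum_(i < n) halfline_kernel K o c g (YX i.+1 w) ^+ 2 + n%:R * a n).
  by near: n; exact: dev.
apply: nnsup_le => [|h]; first by rewrite lee_fin ltW.
rewrite /= in_itv/= => /andP[ah hb].
apply: nnsup_le => [|z Iz]; first by rewrite lee_fin ltW.
apply: nnsup_le => [|t _]; first by rewrite lee_fin ltW.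
rewrite lee_fin emp_cond_cdfE.
have h0 : 0 < h by have /andP[an0 _] := a01 n; exact: lt_le_trans ah.
have cube_r x : centered_cube z (h `^ d%:R^-1) x -> `|x - z| <= r.
  rewrite /centered_cube/= => /le_trans; apply.
  rewrite ler_pdivrMr// mulrC.
  rewrite -(@ler_pXn2r _ d) ?nnegrE ?powR_ge0 ?mulr_ge0 ?(ltW r0)//.
  by rewrite (side_expn d_gt0 h0) (le_trans hb).
have pos x : centered_cube z (h `^ d%:R^-1) x -> 0 < marginal p x.
  move=> /cube_r xr; apply: f_gt0; apply: (closed_nbhd_near Iz).
  exact: le_trans reps.
have closez x o : centered_cube z (h `^ d%:R^-1) x ->
    `|section_below p o x - section_below p o z| <= eta.
  by move=> /cube_r; exact: close.
have Kg : kernel_class K (rescale K h z) by exists h, z.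
have /andP[mf fM] := fmM z Iz.
have moment o c := kernel_second_moment p_density d_gt0 K_regular K_support h0
  (ltW eta0) pos closez o c.
have VB : (marginal p z + eta) * h <= B * h.
  by rewrite ler_wpM2r ?(ltW h0)// lerD// ge_min lexx.
have sums o : `|\sum_(i < n) below o (YX i.+1 w).1 * rescale K h z (YX i.+1 w).2 -
    n%:R * \int[distribution P (YX 0%N)]_u (below o u.1 * rescale K h z u.2)| <=
    dl k * C * (n%:R * h).
  have := @sum_deviation R d (distribution P (YX 0%N)) K K_regular
    (rescale K h z) (fun i => YX i.+1 w) n (a n) (dl k) (B * h) h o Kg.
  rewrite dl0 dl2 => /(_ isT ah (le_trans (moment o false).1 VB)
    (le_trans (moment o true).1 VB) (le_trans (moment o true).2 VB)
    (fun c => devn o c _ Kg)) /le_trans; apply.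
  by rewrite -/kappa /C le_eqVlt; apply/orP; left; apply/eqP; ring.
have mean := kernel_mean p_density d_gt0 K_regular K_support h0 (ltW eta0) pos closez None.
rewrite section_belowT -/kappa in mean.
have cdf := kernel_mean_cond_cdf p_density d_gt0 K_regular K_support h0 (ltW eta0) pos closez t.
rewrite -/kappa in cdf.
have ktau : kappa * eta <= tau by rewrite mulrC -ler_pdivlMr// ge_min lexx orbT.
have tau1 : tau <= m / 4 by rewrite ge_min lexx.
have tau2 : tau <= rho * m / 8 by rewrite ge_min lexx orbT.
have fz : 0 < marginal p z by exact: lt_le_trans mf.
apply: (ratio_deviation n0 h0 m0 mf _ (sums (Some t)) (sums None) cdf mean).
- have -> : cond_cdf p t z = section_below p (Some t) z / marginal p z.
    by rewrite section_below_itv.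
  rewrite divr_ge0 ?(section_below_ge0 p_density) ?(ltW fz)//=.
  by rewrite ler_pdivrMr// mul1r (section_below_le p_density).
- by rewrite mulr_ge0// ltW.
- by rewrite mulr_ge0// ltW.
- exact: le_trans kP tau1.
- exact: le_trans ktau tau1.
- exact: le_trans kP tau2.
- exact: le_trans ktau tau2.
Unshelve. all: by end_near. Qed.
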